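(* Let $x_-$ be the real number defined in the context. Then $$t(K_n)\ge (2x_- + o(1))\,n^2 = (4x_- + o(1))\,|E(K_n)| > 0.5964\, n^2.$$
   Context: Let $y_1,z_1$ solve $y_1'(x)=\frac{1}{1-z_1(x)}$, $z_1'(x)=\frac{1}{2z_1(x)}-\frac{1}{2(1-z_1(x))}$ with $y_1(0)=z_1(0)=0$, and let $\bar x$ be the value of $x$ with $y_1(x)+2z_1(x)=1$. Let $y_2,z_2$ solve $y_2'(x)=\frac{1}{1-z_2(x)}$, $z_2'(x)=\frac{1}{2(1-y_2(x)-z_2(x))}-\frac{1}{2(1-z_2(x))}$ with $y_2(\bar x)=y_1(\bar x)$, $z_2(\bar x)=z_1(\bar x)$, and let $x_-$ be the value of $x$ for which $y_2(x)+z_2(x)=1$. Toppling game: on a graph $G$, configurations $c:V(G)\to\mathbb{N}\cup\{0\}$; a vertex with at least $\deg(v)$ chips may fire, losing $\deg(v)$ chips and sending one to each neighbour; a configuration is volatile if there is an infinite sequence of vertices that may be fired in order. Max and Min alternately place one chip on a vertex (Max first); the game ends once the configuration is volatile; Max maximizes and Min minimizes the number of chips placed. $t(G)$ is the length of the game under optimal play. *)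

(* Defs.v *)
From HB Require Import structures.
From mathcomp Require Import all_boot all_order all_algebra.
From mathcomp Require Import all_classical all_reals all_analysis.
Set Implicit Arguments.
Unset Strict Implicit.
Unset Printing Implicit Defensive.
Import Order.TTheory GRing.Theory Num.Theory.
Import numFieldNormedType.Exports.

Record sgraph := SGraph {
  vertex :> finType;
  adj : rel vertex;
  adj_sym : symmetric adj;
  adj_irr : irreflexive adj }.

Section TopplingGame.
Variable G : sgraph.
Local Open Scope nat_scope.

Definition edges : {set {set G}} :=
  [set [set p.1; p.2] | p : G * G & adj p.1 p.2].

Definition deg (v : G) : nat := #|[set w | adj v w]|.

Definition config := {ffun G -> nat}.

Definition fireable (c : config) (v : G) : Prop := deg v <= c v.

Definition fire (c : config) (v : G) : config :=
  [ffun w => if w == v then c v - deg v else c w + adj v w].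

Fixpoint fires (c : config) (s : nat -> G) (k : nat) : config :=
  if k is k'.+1 then fire (fires c s k') (s k') else c.

Definition volatile (c : config) : Prop :=
  exists s : nat -> G, forall k, fireable (fires c s k) (s k).

Definition add_chip (c : config) (v : G) : config :=
  [ffun w => c w + (w == v)].

Inductive player := Max | Min.

(* [game_value p c m]: under optimal play from [c], with [p] to move, exactly
   [m] further chips are placed.  [f v] is the value of the position reached by
   placing a chip on [v], and [v0] is a best move. *)
Inductive game_value : player -> config -> nat -> Prop :=
| GameOver p c : volatile c -> game_value p c 0
| MaxMove c (f : G -> nat) (v0 : G) :
    ~ volatile c ->
    (forall v, game_value Min (add_chip c v) (f v)) ->
    (forall v, f v <= f v0) ->
    game_value Max c (f v0).+1
| MinMove c (f : G -> nat) (v0 : G) :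
    ~ volatile c ->
    (forall v, game_value Max (add_chip c v) (f v)) ->
    (forall v, f v0 <= f v) ->
    game_value Min c (f v0).+1.

Definition empty_config : config := [ffun=> 0].

(* The default 0 is used only for the graph without vertices: see [game_lengthP]. *)
Definition game_length : nat := xget 0 [set m | game_value Max empty_config m].

Lemma game_value_inj p c m1 m2 :
  game_value p c m1 -> game_value p c m2 -> m1 = m2.
Proof.
move=> h; elim: h m2 => {p c m1} [p c Vc|c f v0 Vc _ IH fM|c f v0 Vc _ IH fM] m2 h.
- by inversion h.
- inversion h as [|c' g w0 Vc' Hg gM|]; first by [].
  have fg v : f v = g v by exact: IH.
  by congr _.+1; apply/eqP; rewrite eqn_leq {1}fg gM -fg fM.
- inversion h as [| |c' g w0 Vc' Hg gM]; first by [].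
  have fg v : f v = g v by exact: IH.
  by congr _.+1; apply/eqP; rewrite eqn_leq -fg fM {1}fg fg gM.
Qed.

Lemma sum_fire (c : config) (v : G) :
  fireable c v -> \sum_w fire c v w = \sum_w c w.
Proof.
move=> cv; rewrite (bigD1 v) //= [RHS](bigD1 v) //= ffunE eqxx.
rewrite (eq_bigr (fun w => c w + adj v w)); last first.
  by move=> w /negPf wv; rewrite ffunE wv.
rewrite big_split /= addnCA addnC; congr addn.
suff -> : \sum_(i | i != v) adj v i = deg v by rewrite subnK.
rewrite /deg -sum1_card [RHS]big_mkcond [RHS](bigD1 v) //= finset.in_set adj_irr add0n.
by apply: eq_bigr => w _; rewrite finset.in_set; case: (adj v w).
Qed.

Lemma volatile_of_many_chips (c : config) :
  0 < #|G| -> \sum_v deg v <= \sum_v c v -> volatile c.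
Proof.
move=> /card_gt0P[x0 _] Hc.
pose pk (d : config) : G := odflt x0 [pick v | deg v <= d v].
have pkP (d : config) : \sum_v deg v <= \sum_v d v -> fireable d (pk d).
  move=> Hd; rewrite /pk; case: pickP => //= nd.
  have: \sum_v d v < \sum_v deg v.
    rewrite (bigD1 x0) //= [X in _ < X](bigD1 x0) //= -addSn leq_add //.
      by rewrite ltnNge nd.
    by apply: leq_sum => v _; apply: ltnW; rewrite ltnNge nd.
  by rewrite ltnNge Hd.
pose d := fix d k := if k is k'.+1 then fire (d k') (pk (d k')) else c.
have dE k : fires c (pk \o d) k = d k by elim: k => //= k ->.
exists (pk \o d) => k; rewrite dE /=; apply: (pkP).
by elim: k => //= k IH; rewrite sum_fire //; exact: pkP.
Qed.

Lemma game_value_exists (p : player) (c : config) :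
  0 < #|G| -> exists m, game_value p c m.
Proof.
move=> G0; have /card_gt0P[x0 _] := G0.
have [k ck] := ubnP (\sum_v deg v - \sum_v c v).
elim: k p c ck => // k IH p c ck.
have [Vc|Vc] := pselect (volatile c); first by exists 0; exact: GameOver.
have cd : \sum_v c v < \sum_v deg v.
  by rewrite ltnNge; apply/negP => /(volatile_of_many_chips G0).
have {}IH q v : exists m, game_value q (add_chip c v) m.
  apply: IH; suff -> : \sum_w add_chip c v w = (\sum_w c w).+1.
    by apply: leq_trans (ck : _ <= k); rewrite subnS prednK ?subn_gt0.
  under eq_bigr do rewrite ffunE.
  rewrite big_split /= -addn1; congr addn.
  by rewrite (bigD1 v) //= eqxx big1 // => w /negPf->.
case: p.
- have [f fP] := choice (IH Min).
  case: (@arg_maxnP _ x0 xpredT f isT) => v0 _ fM.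
  by exists (f v0).+1; apply: MaxMove => // v; exact: fM.
- have [f fP] := choice (IH Max).
  case: (@arg_minnP _ x0 xpredT f isT) => v0 _ fM.
  by exists (f v0).+1; apply: MinMove => // v; exact: fM.
Qed.

Lemma game_lengthP : 0 < #|G| -> game_value Max empty_config game_length.
Proof.
move=> /(game_value_exists Max empty_config) ex_m.
exact: (@xgetPex _ 0 [set m | game_value Max empty_config m] ex_m).
Qed.

End TopplingGame.

Section CompleteGraph.
Variable n : nat.

Fact complete_sym : symmetric (fun x y : 'I_n => x != y).
Proof. by move=> x y; rewrite eq_sym. Qed.

Fact complete_irr : irreflexive (fun x y : 'I_n => x != y).
Proof. by move=> x; rewrite eqxx. Qed.

Definition complete_graph : sgraph := SGraph complete_sym complete_irr.

End CompleteGraph.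

Local Open Scope classical_set_scope.
Local Open Scope ring_scope.

(* The right-hand side for z is singular where the phase starts (z = 0), so the
   equations are imposed on the open interval only, with y and z continuous on
   the closed one.  Inversion being total, the denominators are explicitly
   required not to vanish; it follows that z > 0 on ]0, xbar[. *)
Definition phase1 (R : realType) (y z : R -> R) (xbar : R) : Prop :=
  0 < xbar /\
  {within `[0, xbar], continuous y} /\
  {within `[0, xbar], continuous z} /\
  y 0 = 0 /\ z 0 = 0 /\
  (forall x, 0 < x < xbar ->
    z x != 0 /\ 1 - z x != 0 /\
    is_derive x 1 y (1 / (1 - z x)) /\
    is_derive x 1 z (1 / (2 * z x) - 1 / (2 * (1 - z x)))) /\
  y xbar + 2 * z xbar = 1.

(* Here the singularity (y + z = 1) is at the right end point. *)
Definition phase2 (R : realType) (y1 z1 y z : R -> R) (xbar xminus : R)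
    : Prop :=
  xbar < xminus /\
  {within `[xbar, xminus], continuous y} /\
  {within `[xbar, xminus], continuous z} /\
  y xbar = y1 xbar /\ z xbar = z1 xbar /\
  (forall x, xbar < x < xminus ->
    1 - y x - z x != 0 /\ 1 - z x != 0 /\
    is_derive x 1 y (1 / (1 - z x)) /\
    is_derive x 1 z (1 / (2 * (1 - y x - z x)) - 1 / (2 * (1 - z x)))) /\
  y xminus + z xminus = 1.

(* Main.v *)
Require Import Defs.
From HB Require Import structures.
From mathcomp Require Import all_boot all_order all_algebra.
From mathcomp Require Import all_classical all_reals all_analysis.
From mathcomp Require Import zify ring lra.
Import Order.TTheory GRing.Theory Num.Theory.
Import numFieldNormedType.Exports.
Local Open Scope classical_set_scope.
Local Open Scope ring_scope.

(** Idea.  Cut the cycle Z/n at a level a and write the chip counts as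
    c_v = a + n w_v + p_v with 0 <= p_v < n; put y = a + sum_v w_v and l = n - y.
    The position is not volatile as soon as #{v | t <= p_v} < l - t for some
    t >= 1, that is, unless the staircase t |-> #{v | t <= p_v} covers the
    triangle below t |-> l - t.

    Let h be the largest p_v, u the number of v with p_v > 0 and r = max(h, u).
    Max lifts a highest vertex over the cut (n - h chips) if h = r, and otherwise
    lifts every vertex at the cut by one and moves the cut up (n - u chips).
    Either way y grows by 1 and the covered area of the triangle loses
    min(r, l - 1), while Min, having n - r moves in the meantime, adds at most
    n - r to it.  As the staircase lies in an r x r square, the covered area is
    at most r^2 - max(0, 2r - l)^2 / 2.  The differential equations describe
    exactly the case of equality (z = r/n, covered area = 2x - y), so by
    comparison the area stays below 2x - y up to O(1/n); there is no error
    accumulation because z is monotone and the errors telescope.  When the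
    triangle is full the number of chips is at least about (n^2 + y^2) / 2, and
    2 x_- = (1 + y_-^2) / 2.

    For the numerical value both phases are integrated explicitly:
    (1 - 2 z) exp(2 (y + z)) is constant in the first one and
    (s^2 + M^2) exp(-2 atan(M / s)), with s = 1 - z and M = 1 - y - z, in the
    second one. *)

(** * The toppling game on complete graphs *)

Lemma volatile_add_chip {G : sgraph} (c : config G) (v : G) :
  volatile c -> volatile (add_chip c v).
Proof.
move=> [s fs]; exists s => k.
have -> : fires (add_chip c v) s k = add_chip (fires c s k) v.
  elim: k => //= k ->; apply/ffunP => w; rewrite !ffunE.
  have := fs k; rewrite /fireable => Hk.
  by case: eqP => [->|_]; [rewrite addnBAC | rewrite addnAC].
by apply: leq_trans (fs k) _; rewrite ffunE leq_addr.
Qed.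

Definition add_chips {G : sgraph} : config G -> seq G -> config G :=
  foldl (@add_chip G).

Lemma add_chipsE {G : sgraph} (c : config G) (s : seq G) (w : G) :
  add_chips c s w = (c w + count_mem w s)%N.
Proof.
elim: s c => [|v s IH] c /=; first by rewrite addn0.
by rewrite IH ffunE eq_sym addnA.
Qed.

Lemma volatile_add_chips {G : sgraph} (c : config G) (s : seq G) :
  volatile c -> volatile (add_chips c s).
Proof. by elim: s c => //= v s IH c /(volatile_add_chip _ v)/IH. Qed.

(** Max may commit to a block [s] in advance: [s'] collects the optimal replies of Min, and the
    interleaving is immaterial because only chip counts matter. Max's moves need not be optimal, so
    each round lowers the value by at least two. *)
Lemma game_block {G : sgraph} (s : seq G) (c : config G) (m : nat) :
  game_value Max c m ->
  exists2 s' : seq G, size s' = size s &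
    volatile (add_chips c (s ++ s')) \/
    exists2 m', game_value Max (add_chips c (s ++ s')) m' &
      (2 * size s + m' <= m)%N.
Proof.
elim: s c m => [|v s IH] c m cm.
  by exists [::] => //; right; exists m.
have vol : volatile c \/ volatile (add_chip c v) -> exists2 s' : seq G,
    size s' = size (v :: s) &
    volatile (add_chips c ((v :: s) ++ s')) \/
    exists2 m', game_value Max (add_chips c ((v :: s) ++ s')) m' &
      (2 * size (v :: s) + m' <= m)%N.
  (* If play stops early, [s'] is filled up with arbitrary chips, since volatility survives extra
     chips. *)
  move=> H; exists (v :: s) => //; left; apply: (@volatile_add_chips _ _ (s ++ v :: s)).
  by case: H => // /(volatile_add_chip _ v).
inversion cm as [p c' Vc|c' f v0 Vc fP fM|]; subst; first by apply: vol; left.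
have fv := fP v.
inversion fv as [p c'' Vv e1 e2 e3| |c'' g w0 Vv gP gM]; subst.
  by apply: vol; right.
have [s' ss' H'] := IH _ _ (gP w0).
have E : add_chips c ((v :: s) ++ w0 :: s')
         = add_chips (add_chip (add_chip c v) w0) (s ++ s').
  apply/ffunP => w; rewrite !add_chipsE !ffunE /= !count_cat /=.
  by rewrite (eq_sym v) (eq_sym w0); lia.
exists (w0 :: s'); first by rewrite /= ss'.
rewrite E; case: H' => [|[m' gm' le]]; [by left|right; exists m' => //].
by have := fM v; simpl in *; lia.
Qed.

(* Firing a vertex lowers both s and the sum by exactly one. *)
Lemma complete_not_volatile (n : nat) (c : config (complete_graph n)) (s : nat) :
  (\sum_v ((c v + s) %/ n) < s)%N -> ~ volatile c.
Proof.
move=> cs [t ft].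
suff H k : (k <= s)%N /\ (\sum_v ((fires c t k v + (s - k)) %/ n) < s - k)%N.
  by have [] := H s.+1; rewrite ltnn.
elim: k => [|k [ks IH]]; first by rewrite subn0.
have ks' : (k < s)%N by rewrite -subn_gt0; apply: leq_ltn_trans IH.
split=> //.
set d := fires c t k in IH; set v := t k.
have n0 : (0 < n)%N by apply: leq_ltn_trans (ltn_ord v).
have dv : deg v = n.-1.
  rewrite /deg (_ : [set w | adj v w] = ~: [set v])%SET ?cardsC1 ?card_ord //.
  by apply/setP => w; rewrite !inE /= eq_sym.
have fv : (n.-1 <= d v)%N by rewrite -dv; exact: ft.
suff : (\sum_w ((fire d v w + (s - k.+1)) %/ n)).+1 = (\sum_w ((d w + (s - k)) %/ n))%N.
  by move=> E; rewrite -E -(subnSK ks') ltnS in IH.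
rewrite (bigD1 v) //= [RHS](bigD1 v) //= -addSn; congr addn.
  rewrite ffunE eqxx dv.
  have -> : (d v + (s - k) = n + (d v - n.-1 + (s - k.+1)))%N by lia.
  by rewrite (divnDl _ (dvdnn n)) divnn n0.
apply: eq_bigr => w wv; rewrite ffunE (negPf wv).
have -> : adj v w by rewrite /= eq_sym.
by rewrite -(subnSK ks') addn1 addSnnS.
Qed.

(** * The part of the triangle covered by the staircase *)

Definition height_count {V : finType} (p : V -> nat) (t : nat) : nat :=
  \sum_v (t <= p v)%N.

Definition level_area {V : finType} (p : V -> nat) (l : nat) : nat :=
  \sum_(1 <= t < l) minn (height_count p t) (l - t).

Lemma sum_nat_leq (h l : nat) : (\sum_(1 <= t < l.+1) (t <= h) = minn h l)%N.
Proof.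
elim: l => [|l IH]; first by rewrite big_geq // minn0.
rewrite big_nat_recr //= IH; case: (leqP l.+1 h) => H; last by lia.
by rewrite /= addn1; lia.
Qed.

Lemma level_area_le_sum {V : finType} (p : V -> nat) (l : nat) :
  (level_area p l <= \sum_v p v)%N.
Proof.
case: l => [|l]; first by rewrite /level_area big_geq.
apply: (@leq_trans (\sum_(1 <= t < l.+1) height_count p t)).
  by apply: leq_sum => t _; exact: geq_minl.
rewrite exchange_big /=; apply: leq_sum => v _.
by rewrite sum_nat_leq geq_minl.
Qed.

(** In each row t <= [p v] both arguments of the minimum drop by one, so such a row loses exactly
    one cell. *)
Lemma level_area_row {V : finType} (p p' : V -> nat) (v : V) (l : nat) :
  p' v = 0%N -> (forall u, u != v -> p' u = p u) ->
  (level_area p' l.-1 + minn (p v) l.-1 <= level_area p l)%N.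
Proof.
move=> pv pu; case: l => [|l] /=; first by rewrite /level_area !big_geq // minn0.
have -> : level_area p' l = (\sum_(1 <= t < l.+1) minn (height_count p' t) (l - t))%N.
  case: l => [|l]; first by rewrite /level_area !big_geq.
  by rewrite [RHS]big_nat_recr //= subnn minn0 addn0.
rewrite -sum_nat_leq -big_split /= /level_area big_nat [leqRHS]big_nat.
apply: leq_sum => t /andP[t1 tl].
have -> : height_count p t = (height_count p' t + (t <= p v))%N.
  rewrite /height_count (bigD1 v) //= [in RHS](bigD1 v) //= pv (leqNgt t 0) t1 /= add0n.
  by rewrite addnC; congr addn; apply: eq_bigr => u uv; rewrite pu.
by case: (t <= p v)%N; lia.
Qed.

(** Lowering all heights shifts the rows down by one, and row t + 1 under [l] has the same cap as
    row t under [l.-1]; only row 1 is lost. *)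
Lemma level_area_column {V : finType} (p : V -> nat) (l : nat) :
  (level_area (fun v => (p v).-1) l.-1 + minn (height_count p 1) l.-1
    <= level_area p l)%N.
Proof.
case: l => [|[|l]] /=; rewrite /level_area; try by rewrite !big_geq // ?minn0.
rewrite [leqRHS]big_ltn // subn1 /= addnC leq_add2l.
rewrite -[X in (_ <= \sum_(X <= _ < _) _)%N](addn1 1) -[X in (_ <= \sum_(_ <= _ < X) _)%N]addn1.
rewrite big_addn addn1 subn1 /= big_nat [leqRHS]big_nat.
apply: leq_sum => t /andP[t1 tl]; rewrite addn1 subSS.
rewrite (_ : height_count _ t = height_count p t.+1) //.
by apply: eq_bigr => v _; congr nat_of_bool; lia.
Qed.

Lemma level_area_chip {V : finType} (p p' : V -> nat) (v : V) (l : nat) :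
  p' v = (p v).+1 -> (forall u, u != v -> p' u = p u) ->
  (level_area p' l <= (level_area p l).+1)%N.
Proof.
move=> pv pu.
apply: (@leq_trans (level_area p l + \sum_(1 <= t < l) (t == (p v).+1))%N).
  rewrite -big_split /=; apply: leq_sum => t _.
  have -> : height_count p' t = (height_count p t + (t == (p v).+1))%N.
    rewrite /height_count (bigD1 v) //= [in RHS](bigD1 v) //= pv.
    rewrite (eq_bigr (fun u => (t <= p u) : nat)) => [|u uv]; last by rewrite pu.
    by lia.
  by case: (_ == _); lia.
rewrite -[leqRHS]addn1 leq_add2l; elim: l => [|l IH]; first by rewrite big_geq.
case: l IH => [|l] IH; first by rewrite big_geq.
rewrite big_nat_recr //=; case: eqP => [E|_]; last by rewrite addn0.
rewrite big_nat big1 // => t /andP[_ tl]; case: eqP => // tE.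
by move: tl; rewrite tE E ltnn.
Qed.

(** The row at t falls short of r by t - (l - r) once this is positive. The total deficit is j (j +
    1) / 2 with j = [k - (l - r)]; after doubling, only j^2 of it is kept. *)
Lemma sum_minn_triangle (r l k : nat) : (r <= l -> k <= l ->
  2 * \sum_(1 <= t < k.+1) minn r (l - t) + (k - (l - r)) * (k - (l - r))
    <= 2 * k * r)%N.
Proof.
move=> rl; elim: k => [|k IH] kl; first by rewrite big_geq //; lia.
rewrite big_nat_recr //=; have {IH} := IH (ltnW kl).
have [kd|dk] := leqP k.+1 (l - r); first by nia.
by rewrite (_ : k.+1 - (l - r) = (k - (l - r)).+1)%N; nia.
Qed.

(** The staircase lies in an r x r square, whose corner sticks out of the triangle when l <= 2 r.
    The second bound is r^2 - (2 r - l)^2 / 2, doubled and rearranged to avoid truncated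
    subtraction. *)
Lemma level_area_bound {V : finType} (p : V -> nat) (l r : nat) :
  (forall v, p v <= r)%N -> (height_count p 1 <= r)%N ->
  (level_area p l <= r * r)%N /\
  (r <= l <= 2 * r -> 2 * level_area p l + 2 * (r * r) + l * l <= 4 * (r * l))%N.
Proof.
move=> pr ur.
have cr t : (0 < t)%N -> (height_count p t <= (t <= r) * r)%N.
  move=> t0; case: (leqP t r) => tr /=.
    rewrite mul1n; apply: leq_trans ur; apply: leq_sum => v _.
    by case: (leqP t (p v)) => // /(leq_trans t0) ->.
  by rewrite /height_count big1 // => v _; rewrite leqNgt (leq_ltn_trans (pr v)).
have H1 : (level_area p l <= \sum_(1 <= t < l) (t <= r) * minn r (l - t))%N.
  rewrite /level_area big_nat [leqRHS]big_nat; apply: leq_sum => t /andP[t0 _].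
  by have := cr t t0; case: (leqP t r); lia.
split.
  apply: (leq_trans H1); apply: (@leq_trans (\sum_(1 <= t < l.+1) (t <= r) * r)%N).
    case: l {H1} => [|l]; first by rewrite big_geq.
    rewrite [leqRHS]big_nat_recr //=; apply: leq_trans (leq_addr _ _).
    by apply: leq_sum => t _; rewrite leq_mul2l geq_minl orbT.
  by rewrite -big_distrl /= sum_nat_leq leq_mul2r geq_minl orbT.
move=> /andP[rl l2r].
have H2 : (\sum_(1 <= t < l) (t <= r) * minn r (l - t)
           <= \sum_(1 <= t < r.+1) minn r (l - t))%N.
  apply: (@leq_trans (\sum_(1 <= t < l.+1) (t <= r) * minn r (l - t))%N).
    case: (l) => [|l']; first by rewrite big_geq.
    by rewrite [leqRHS]big_nat_recr //= leq_addr.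
  rewrite (@big_cat_nat _ _ _ r.+1) //= [X in (_ + X)%N]big_nat.
  rewrite [X in (_ + X)%N]big1 ?addn0 => [|t /andP[rt _]]; last first.
    by rewrite leqNgt rt.
  by apply: leq_sum => t _; case: (t <= r)%N; lia.
by have := sum_minn_triangle _ _ _ rl rl; nia.
Qed.

Lemma sum_subn_triangle (l : nat) : (2 * \sum_(1 <= t < l) (l - t) = l * l.-1)%N.
Proof.
case: l => [|l]; first by rewrite big_geq.
rewrite big_add1 /= big_mkord.
rewrite (eq_bigr (fun i : 'I_l => (l - i)%N)) => [|i _]; last by rewrite subSS.
elim: l => [|l IH]; first by rewrite big_ord0.
rewrite big_ord_recl /= subn0.
rewrite (eq_bigr (fun i : 'I_l => (l - i)%N)) => [|i _]; last by rewrite /bump /= add1n subSS.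
by rewrite mulnDr IH; lia.
Qed.

(** A relation, because one configuration may be cut at several levels [a]; the game argument needs
    only [y] and the covered area [b]. *)
Definition position {n : nat} (c : config (complete_graph n)) (y b : nat) : Prop :=
  exists (a : nat) (w p : complete_graph n -> nat),
    (forall v, c v = a + n * w v + p v /\ p v < n)%N /\
    y = (a + \sum_v w v)%N /\ b = level_area p (n - y).

Lemma position_not_volatile {n : nat} (c : config (complete_graph n)) (y b : nat) :
  position c y b -> (2 * b < (n - y) * (n - y).-1)%N -> ~ volatile c.
Proof.
move=> [a [w [p [cE [yE ->]]]]] blt.
have [t /andP[t0 tl] ct] : exists2 t, (0 < t < n - y)%N &
    (height_count p t < n - y - t)%N.
  apply: contrapT => H.
  suff E : level_area p (n - y) = (\sum_(1 <= t < n - y) (n - y - t))%N.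
    by move: blt; rewrite E sum_subn_triangle ltnn.
  rewrite /level_area big_nat [RHS]big_nat; apply: eq_bigr => t tl.
  apply/minn_idPr; rewrite leqNgt; apply/negP => ct; apply: H; by exists t.
have n0 : (0 < n)%N by lia.
have [k kE] : exists k, k = (a + t)%N by exists (a + t)%N.
(* With k = a + t, adding [n * k - k] turns the chip count of v into n (w v + k) + (p v - t), so the
   quotient is w v + k, less one exactly when p v < t. The strict inequality on the sum of quotients
   then reads #{v | t <= p v} < n - y - t. *)
apply: (@complete_not_volatile _ _ (n * k - k)).
have E v : ((c v + (n * k - k)) %/ n + 1 = w v + k + (t <= p v))%N.
  have [-> pn] := cE v.
  case: (leqP t (p v)) => tp.
    have -> : (a + n * w v + p v + (n * k - k) = (w v + k) * n + (p v - t))%N.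
      by nia.
    by rewrite divnMDl // divn_small; lia.
  have -> : (a + n * w v + p v + (n * k - k) = (w v + k).-1 * n + (n + p v - t))%N.
    by nia.
  by rewrite divnMDl // divn_small; lia.
have cardE' : #|complete_graph n| = n := card_ord n.
have : (\sum_v ((c v + (n * k - k)) %/ n + 1) =
        \sum_v w v + n * k + height_count p t)%N.
  by under eq_bigr do rewrite E; rewrite big_split big_split sum_nat_const cardE'.
rewrite big_split sum_nat_const cardE' muln1 => E1.
have nk : (k <= n * k)%N by rewrite leq_pmull.
simpl in *; lia.
Qed.

Lemma position_sum {n : nat} (c : config (complete_graph n)) (y b : nat) :
  position c y b -> (n * y + b <= \sum_v c v)%N.
Proof.
move=> [a [w [p [cE [-> ->]]]]].
rewrite [leqRHS](eq_bigr (fun v => a + n * w v + p v)%N) => [|v _]; last by case: (cE v).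
rewrite !big_split /= sum_nat_const card_ord -big_distrr /= mulnDr leq_add2l.
exact: level_area_le_sum.
Qed.

Definition upd {T : eqType} (f : T -> nat) (v : T) (x : nat) (u : T) : nat :=
  if u == v then x else f u.

Lemma sum_upd {T : finType} (f : T -> nat) (v : T) :
  (\sum_u upd f v (f v).+1 u = (\sum_u f u).+1)%N.
Proof.
rewrite (bigD1 v) //= [in RHS](bigD1 v) //= /upd eqxx addSn; congr (_ + _).+1.
by apply: eq_bigr => u /negPf ->.
Qed.

(** Either the height of [v] stays below n and one row gains at most one cell, or it wraps from n -
    1 to 0; then y grows and the emptied row costs min(n - 1, n - y - 1) cells. *)
Lemma position_add_chip {n : nat} (c : config (complete_graph n)) (v : complete_graph n) (y b : nat) :
  position c y b -> exists b',
    (b' <= b.+1 /\ position (add_chip c v) y b')%N \/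
    (b' + (n - y.+1) <= b /\ position (add_chip c v) y.+1 b')%N.
Proof.
move=> [a [w [p [cE [yE bE]]]]].
have [cv pv] := cE v.
have [pn|pn] := ltnP (p v).+1 n.
  exists (level_area (upd p v (p v).+1) (n - y)); left; split.
    rewrite bE; apply: (@level_area_chip _ _ _ v); first by rewrite /upd eqxx.
    by move=> u /negPf uv; rewrite /upd uv.
  exists a, w, (upd p v (p v).+1); split=> // u; rewrite ffunE /upd.
  case: eqP => [->|_]; last by rewrite addn0.
  by rewrite cv addn1 addnS.
exists (level_area (upd p v 0) (n - y.+1)); right; split.
  have := @level_area_row _ p (upd p v 0) v (n - y).
  rewrite /upd eqxx => /(_ erefl) /(_ _)/wrap[|H]; first by move=> u /negPf ->.
  by rewrite bE subnS; apply: leq_trans H; rewrite leq_add2l; lia.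
exists a, (upd w v (w v).+1), (upd p v 0); split; last first.
  by rewrite sum_upd yE addnS.
move=> u; rewrite ffunE /upd; case: eqP => [->|_]; last by rewrite addn0.
by rewrite cv mulnS; lia.
Qed.

Lemma count_mem_enum_set {T : finType} (A : {set T}) (u : T) :
  count_mem u (enum A) = (u \in A).
Proof. by rewrite count_uniq_mem ?enum_uniq // mem_enum. Qed.

Lemma position_line {n : nat} (c : config (complete_graph n)) (y b : nat) :
  (y < n)%N -> position c y b -> exists r : nat, exists s : seq (complete_graph n), exists b' : nat,
    [/\ (r <= n)%N, size s = (n - r)%N, position (add_chips c s) y.+1 b',
        (b' + minn r (n - y.+1) <= b)%N &
        ((b <= r * r)%N /\
         (r <= n - y <= 2 * r ->
           2 * b + 2 * (r * r) + (n - y) * (n - y) <= 4 * (r * (n - y)))%N)].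
Proof.
move=> yn [a [w [p [cE [yE bE]]]]].
have n0 : (0 < n)%N by apply: leq_ltn_trans yn.
have [v _ vmax] := @arg_maxnP (complete_graph n) (Ordinal n0) xpredT p isT.
have un : (height_count p 1 <= n)%N.
  rewrite -[leqRHS]card_ord -sum1_card; apply: leq_sum => u _.
  by case: (1 <= p u)%N.
have pmax u : (p u <= p v)%N by apply: vmax.
have [cv pv] := cE v.
have [uh|hu] := leqP (height_count p 1) (p v).
  (* Max lifts the highest vertex over the cut: [p v] becomes 0 and [w v] gains one. *)
  exists (p v), (nseq (n - p v) v), (level_area (upd p v 0) (n - y.+1)).
  rewrite size_nseq; split=> //; first exact: ltnW.
  - exists a, (upd w v (w v).+1), (upd p v 0); split; last first.
      by rewrite sum_upd yE addnS.
    move=> u; rewrite add_chipsE /upd count_nseq /= eq_sym.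
    case: eqP => [->|_]; last by rewrite mul0n addn0.
    by rewrite cv mulnS mul1n; lia.
  - have := @level_area_row _ p (upd p v 0) v (n - y).
    rewrite /upd eqxx => /(_ erefl) /(_ _)/wrap[|H]; first by move=> u /negPf ->.
    by rewrite bE subnS.
  - by rewrite bE; exact: level_area_bound.
(* Max puts one chip on every vertex at the cut, and the cut moves up to [a.+1]; all positive
   heights drop by one. *)
exists (height_count p 1), (enum [set u | p u == 0]%SET),
  (level_area (fun u => (p u).-1) (n - y.+1)).
split=> //.
- rewrite -cardE -sum1_card big_mkcond /=.
  have : (height_count p 1 + \sum_u (if u \in [set u | p u == 0]%SET then 1 else 0) = n)%N.
    rewrite -big_split /= -[RHS]card_ord -sum1_card; apply: eq_bigr => u _.
    by rewrite inE; case: (p u).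
  by move=> E; rewrite -[X in (X - _)%N]E addKn.
- exists a.+1, w, (fun u => (p u).-1); split; last by rewrite yE.
  move=> u; rewrite add_chipsE count_mem_enum_set inE.
  by have [-> ] := cE u; case: (p u) => [|k] /=; lia.
- by rewrite bE subnS; exact: level_area_column.
- rewrite bE; apply: level_area_bound => // u.
  exact: leq_trans (pmax u) (ltnW hu).
Qed.

Lemma position_empty (n : nat) : position (empty_config (complete_graph n)) 0 0.
Proof.
exists 0%N, (fun=> 0%N), (fun=> 0%N); split; last first.
  split; first by rewrite big1.
  rewrite /level_area big_nat big1 // => t /andP[t0 _].
  by rewrite /height_count big1 ?min0n // => v _; rewrite leqNgt t0.
by move=> v; rewrite ffunE muln0; split=> //; apply: leq_ltn_trans (ltn_ord v).
Qed.

Lemma sum_add_chips {G : sgraph} (c : config G) (s : seq G) :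
  (\sum_v add_chips c s v = \sum_v c v + size s)%N.
Proof.
elim: s c => [|v s IH] c /=; first by rewrite addn0.
rewrite IH addnS -addSn; congr addn.
rewrite (eq_bigr (fun w => c w + (w == v))%N) => [|w _]; last by rewrite ffunE.
rewrite big_split /= -addn1; congr addn.
by rewrite (bigD1 v) //= eqxx big1 // => w /negPf->.
Qed.

(* G y caps the covered area as a function of y, as long as y <= Y. *)
Section Lines.
Context {R : realFieldType} {n : nat} (G : nat -> R) (Y Z : R).

(** [G_wrap]: a wrapping chip of Min uses at most one unit of slack, like any other chip. [G_line]:
    after Max's block, [n - r] units are in reserve for as many replies. [G_end]: the triangle
    cannot fill up under the cap before y reaches Z. *)
Hypothesis G_wrap : forall y, y.+1%:R <= Y -> G y - (n - y.+1)%:R <= G y.+1 + 1.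
Hypothesis G_line : forall y b r : nat, y.+1%:R <= Y -> (r <= n)%N ->
  b%:R <= G y -> (b <= r * r)%N ->
  (r <= n - y <= 2 * r ->
    2 * b + 2 * (r * r) + (n - y) * (n - y) <= 4 * (r * (n - y)))%N ->
  b%:R - (minn r (n - y.+1))%:R <= G y.+1 - (n - r)%:R.
Hypothesis G_end : forall y b : nat, y%:R <= Y -> b%:R <= G y ->
  ((n - y) * (n - y).-1 <= 2 * b)%N -> Z <= y%:R.
Hypothesis (Z0 : 0 <= Z) (ZY : Z <= Y) (Zn : Z <= n%:R).

(** [d] is the slack relative to the cap, possibly negative; every chip raises it by at most one. *)
Lemma position_add_chips (s : seq (complete_graph n)) (c : config (complete_graph n))
    (y b : nat) (d : R) :
  position c y b -> (y%:R <= Y -> b%:R <= G y + d) ->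
  exists y' b' : nat, [/\ (y <= y')%N, position (add_chips c s) y' b' &
    y'%:R <= Y -> b'%:R <= G y' + d + (size s)%:R].
Proof.
elim: s c y b d => [|v s IH] c y b d cP bG /=.
  by exists y, b; rewrite addr0.
have [b' [[b'b cP']|[b'b cP']]] := @position_add_chip _ _ v _ _ cP.
  have [yY|y' [b'' [yy' P' H]]] := IH _ _ _ (d + 1) cP'.
    apply: (@le_trans _ _ b.+1%:R); first by rewrite ler_nat.
    by rewrite -addn1 natrD addrA lerD2r bG.
  by exists y', b''; split=> // /H; rewrite -(addn1 (size s)) natrD; lra.
have [yY|y' [b'' [yy' P' H]]] := IH _ _ _ (d + 1) cP'.
  have yY' : y%:R <= Y by apply: le_trans yY; rewrite ler_nat.
  have := G_wrap _ yY; have := bG yY'.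
  by move: b'b; rewrite -(ler_nat R) natrD; lra.
exists y', b''; split=> //; first exact: ltnW.
by move=> /H; rewrite -(addn1 (size s)) natrD; lra.
Qed.

(** Induction on n - y, one block of Max with its replies at a time. A full triangle means about n y
    + (n - y)^2 / 2 = (n^2 + y^2) / 2 chips. *)
Lemma line_game_bound (c : config (complete_graph n)) (y b m : nat) :
  position c y b -> (y%:R <= Y -> b%:R <= G y) ->
  (2 * b < (n - y) * (n - y).-1)%N -> game_value Max c m ->
  (n%:R ^+ 2 + Z ^+ 2) / 2 - 5 / 2 * n%:R <= (\sum_v c v + m)%:R.
Proof.
have [k] := ubnP (n - y).
elim: k c y b m => // k IH c y b m yk cP bG nv cm.
have yn : (y < n)%N by case: (ltnP y n) nv => // ?; rewrite (_ : n - y = 0)%N //; lia.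
have [r [s [b1 [rn ss P1 b1b [br1 br2]]]]] := position_line _ _ _ yn cP.
have [s' ss' H] := @game_block _ s _ _ cm.
have bG1 : y.+1%:R <= Y -> b1%:R <= G y.+1 + - (n - r)%:R.
  move=> yY; have yY' : y%:R <= Y by apply: le_trans yY; rewrite ler_nat.
  apply: (le_trans _ (G_line _ _ _ yY rn (bG yY') br1 br2)).
  by rewrite lerBrDr -natrD ler_nat.
(* The reserve [n - r] covers exactly the replies of Min, one unit per chip. *)
have [y' [b' [yy' P' bG']]] := position_add_chips s' _ _ _ _ P1 bG1.
have {}bG' : y'%:R <= Y -> b'%:R <= G y'.
  by move/bG'; rewrite ss' ss; lra.
rewrite /add_chips foldl_cat -!/(add_chips _ _) in H.
set c' := add_chips _ s' in P' H.
have c'E : (\sum_v c' v = \sum_v c v + 2 * (n - r))%N.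
  by rewrite !sum_add_chips ss' ss -addnA addnn -mul2n.
have [nv'|ve] := ltnP (2 * b')%N ((n - y') * (n - y').-1)%N.
  case: H => [/(position_not_volatile _ _ _ P' nv') //|[m' cm' mm']].
  have yk' : (n - y' < k)%N by clear -yk yy' yn; lia.
  apply: le_trans (IH _ _ _ _ yk' P' bG' nv' cm') _.
  by rewrite ler_nat c'E -addnA leq_add2l -ss.
have Zy' : Z <= y'%:R.
  have [yY|/ltW] := leP y'%:R Y; last exact: le_trans.
  exact: G_end _ _ _ (bG' yY) ve.
(* The triangle may fill up inside the last block, which has at most 2 n chips. Together with the
   loss of at most n / 2 from l (l - 1) / 2 in place of l^2 / 2, this gives the constant 5 / 2. *)
have S' : (n * y' + b' <= \sum_v c v + 2 * n)%N.
  by apply: leq_trans (position_sum _ _ _ P') _; rewrite c'E leq_add2l leq_mul2l leq_subr.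
apply: (@le_trans _ _ (\sum_v c v)%:R); last by rewrite ler_nat leq_addr.
have S1 : (n * y' + b')%:R <= (\sum_v c v + 2 * n)%:R :> R by rewrite ler_nat.
have S2 : ((n - y') * (n - y').-1)%:R <= (2 * b')%:R :> R by rewrite ler_nat.
move: S1 S2; rewrite !natrD !natrM => S1 S2.
have [ny|ny] := leqP n y'.
  have ny2 : n%:R <= y'%:R :> R by rewrite ler_nat.
  have b0 : 0 <= b'%:R :> R by [].
  have n0 : 0 <= n%:R :> R by [].
  have nn : n%:R * n%:R <= n%:R * y'%:R :> R by rewrite ler_wpM2l.
  have ZZ : Z * Z <= n%:R * n%:R by rewrite ler_pM.
  by lra.
have l1 : (n - y').-1%:R = n%:R - y'%:R - 1 :> R.
  by rewrite -subn1 natrB ?subn_gt0 // natrB // ltnW.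
rewrite l1 natrB in S2; last exact: ltnW.
have n0 : 0 <= n%:R :> R by [].
have y0 : 0 <= y'%:R :> R by [].
have ZZ : Z * Z <= y'%:R * y'%:R by rewrite ler_pM.
by lra.
Qed.

Lemma line_game_length (b0 : 0 <= G 0) : (1 < n)%N ->
  (n%:R ^+ 2 + Z ^+ 2) / 2 - 5 / 2 * n%:R <= (game_length (complete_graph n))%:R.
Proof.
move=> n1; have n0 : (0 < #|complete_graph n|)%N by rewrite card_ord ltnW.
have := line_game_bound _ _ _ _ (position_empty n) (fun=> b0) _ (game_lengthP n0).
rewrite (_ : \sum_v _ = 0)%N ?add0n; last by rewrite big1 // => v _; rewrite ffunE.
by apply; rewrite subn0 muln_gt0; lia.
Qed.

End Lines.

(** * Comparison with the solution of the differential equations *)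

(** [X] and [Z] stand for x and z as functions of u = y / n. [X_incr] integrates dx/dy = 1 - z;
    [X_small] and [X_large] say that 2x - y equals the staircase bound for a square of side z,
    without and with a protruding corner. *)
Section Profile.
Context {R : realFieldType} (X Z : R -> R) (yf : R).

Hypothesis (yf0 : 0 <= yf) (yf1 : yf <= 1) (X0 : 0 <= X 0).
Hypothesis Z_ge0 : forall u : R, 0 <= u <= yf -> 0 <= Z u.
Hypothesis Z_le : forall u : R, 0 <= u <= yf -> Z u <= 1 - u.
Hypothesis Z_mono : forall u v : R, 0 <= u -> u <= v -> v <= yf -> Z u <= Z v.
Hypothesis X_incr : forall u v : R, 0 <= u -> u <= v -> v <= yf ->
  (1 - Z v) * (v - u) <= X v - X u.
Hypothesis X_small : forall u : R, 0 <= u <= yf -> 2 * Z u <= 1 - u ->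
  2 * X u - u = Z u ^+ 2.
Hypothesis X_large : forall u : R, 0 <= u <= yf -> 1 - u <= 2 * Z u ->
  2 * X u - u = 2 * Z u * (1 - u) - Z u ^+ 2 - (1 - u) ^+ 2 / 2.
Hypothesis Z_end : Z yf = 1 - yf.

Let N (n : nat) : R := n%:R.
(** The limiting area n^2 (2x - y), plus a term whose increments pay for estimating the slope with
    [Z] at the right end of each step. *)
Let budget (n y : nat) : R :=
  N n ^+ 2 * (2 * X (y%:R / N n) - y%:R / N n) + 2 * (N n * Z (y%:R / N n)).

Lemma budget_step (n y : nat) : (0 < n)%N -> y.+1%:R <= N n * yf ->
  let u := y%:R / N n in let v := y.+1%:R / N n in
  [/\ 0 <= u <= yf, 0 <= v <= yf, Z u <= Z v, N n * Z v <= (n - y.+1)%:R &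
      N n * (1 - 2 * Z v)
      <= N n ^+ 2 * (2 * X v - v) - N n ^+ 2 * (2 * X u - u)].
Proof.
move=> n0 yY u v; have N0 : 0 < N n by rewrite ltr0n.
have vE : v = u + (N n)^-1 by rewrite /u /v -addn1 natrD mulrDl mul1r.
have NV : N n * (N n)^-1 = 1 by rewrite divff // gt_eqF.
have i0 : 0 < (N n)^-1 by rewrite invr_gt0.
have u0 : 0 <= u by rewrite divr_ge0 // ltW.
have uv : u <= v by rewrite vE lerDl ltW.
have vf : v <= yf by rewrite ler_pdivrMr // mulrC.
have uu : 0 <= u <= yf by rewrite u0 (le_trans uv).
have vv : 0 <= v <= yf by rewrite vf (le_trans u0).
have zz := Z_mono _ _ u0 uv vf.
have Nv : N n * v = y.+1%:R by rewrite mulrC divfK // gt_eqF.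
split=> //.
  have yn : (y.+1 <= n)%N.
    by rewrite -(ler_nat R) (le_trans yY) // ler_piMr // ltW.
  rewrite natrB // -/(N n) -Nv -{2}(mulr1 (N n)) -mulrBr ler_pM2l //.
  exact: Z_le.
have := X_incr _ _ u0 uv vf.
rewrite (_ : v - u = (N n)^-1); last by rewrite vE addrAC subrr add0r.
move=> H.
have H2 : N n ^+ 2 * ((1 - Z v) * (N n)^-1) <= N n ^+ 2 * (X v - X u).
  by rewrite ler_pM2l // exprn_gt0.
have E : N n ^+ 2 * ((1 - Z v) * (N n)^-1) = N n * (1 - Z v).
  by rewrite -[RHS]mul1r -NV; ring.
have E2 : N n ^+ 2 * (v - u) = N n.
  by rewrite vE -[RHS]mulr1 -NV; ring.
by lra.
Qed.

(** [S] bounds how far before n [yf] the triangle can already be full, owing to the lower order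
    terms of the budget. *)
Lemma profile_game_length (n : nat) (S : R) : (1 < n)%N -> 0 <= S ->
  10 * N n <= S ^+ 2 ->
  (N n ^+ 2 + Num.max 0 (N n * yf - S) ^+ 2) / 2 - 5 / 2 * N n
    <= (game_length (complete_graph n))%:R.
Proof.
move=> n1 S0 NS; have n0 : (0 < n)%N by exact: ltnW.
have N0 : 0 < N n by rewrite ltr0n.
have NN0 := ltW N0.
have NV : N n / N n = 1 by rewrite divff // gt_eqF.
have Nf : N n * yf <= N n by rewrite ler_piMr.
apply: (@line_game_length _ _ (budget n) (N n * yf)) => //.
- move=> y yY; have [uu vv zz Zl H] := budget_step _ _ n0 yY.
  rewrite /budget; have : 0 <= N n * (Z (y.+1%:R / N n) - Z (y%:R / N n)).
    by rewrite mulr_ge0 // subr_ge0.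
  have : (n - y.+1)%:R <= N n by rewrite ler_nat leq_subr.
  by lra.
- move=> y b r yY rn bG br1 br2.
  have [uu vv zz Zl H] := budget_step _ _ n0 yY.
  move: bG; rewrite /budget.
  set u := y%:R / N n in uu zz H *; set v := y.+1%:R / N n in vv zz Zl H *.
  move=> bG; rewrite natrB // -/(N n).
  have r0 : 0 <= r%:R :> R by [].
  have m0 : 0 <= (minn r (n - y.+1))%:R :> R by [].
  (* If [b] is at most the main term, the extra 2 n Z(u) is still available. Otherwise the staircase
     bound, increasing in r, forces r >= n Z(u), so [r] and the minimum together make up for 2 n
     Z(u). *)
  have [small|big] := leP b%:R (N n ^+ 2 * (2 * X u - u)); first by lra.
  have zu0 := Z_ge0 _ uu.
  have zul := Z_le _ uu.
  have yn : (y <= n)%N.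
    rewrite ltnW // -(ler_nat R); exact: le_trans yY Nf.
  have Nu : N n * u = y%:R by rewrite mulrC divfK // gt_eqF.
  have lE : (n - y)%:R = N n * (1 - u) :> R by rewrite natrB // mulrBr mulr1 Nu.
  have rZ : N n * Z u <= r%:R.
    rewrite leNgt; apply/negP => rZ.
    have ql : N n * Z u <= (n - y)%:R by rewrite lE ler_pM2l.
    have rl : (r <= n - y)%N by rewrite -(ler_nat R); lra.
    have Xq : N n ^+ 2 * (2 * X u - u) =
        if 2 * Z u <= 1 - u then (N n * Z u) ^+ 2
        else 2 * (N n * Z u) * (n - y)%:R - (N n * Z u) ^+ 2 - (n - y)%:R ^+ 2 / 2.
      by case: leP => [/(X_small _ uu) ->|/ltW/(X_large _ uu) ->]; rewrite ?lE; ring.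
    have b1 : b%:R <= r%:R * r%:R :> R by rewrite -natrM ler_nat.
    rewrite {}Xq in big.
    set q := N n * Z u in rZ ql big; set l : R := (n - y)%:R in lE ql big.
    have l0 : 0 <= l by [].
    have q0 : 0 <= q by rewrite mulr_ge0.
    have q2 : (2 * Z u <= 1 - u) = (2 * q <= l).
      by rewrite lE /q mulrCA ler_pM2l.
    rewrite q2 in big.
    have [rl2|rl2] := leqP (n - y) (2 * r).
      have := br2; rewrite rl rl2 => /(_ isT).
      rewrite -(ler_nat R) !natrD !natrM -/l => b2.
      have rl2' : l <= 2 * r%:R by rewrite -natrM ler_nat.
      case: (leP (2 * q) l) big => _ big; first by nra.
      have : 0 <= (q - r%:R) * (2 * l - q - r%:R) by rewrite mulr_ge0 //; lra.
      by lra.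
    have rl2' : 2 * r%:R <= l by rewrite -natrM ler_nat ltnW.
    case: (leP (2 * q) l) big => ql2 big; first by nra.
    (* Here r < l / 2 < q, and the two formulas are compared through r = l / 2, where both equal l^2
       / 4. *)
    have : 0 <= (q - l / 2) * (2 * l - q - l / 2) by rewrite mulr_ge0 //; lra.
    have : r%:R * r%:R <= l / 2 * (l / 2) by rewrite ler_pM //; lra.
    by lra.
  have mZ : N n * Z u <= (minn r (n - y.+1))%:R.
    rewrite /minn; case: ifP => // _; apply: le_trans Zl.
    by rewrite ler_pM2l.
  by lra.
- move=> y b yY bG lb.
  set u := y%:R / N n.
  have u0 : 0 <= u by rewrite divr_ge0.
  have uf : u <= yf by rewrite ler_pdivrMr // mulrC.
  have uu : 0 <= u <= yf by rewrite u0.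
  have yn : (y <= n)%N by rewrite -(ler_nat R); exact: le_trans yY Nf.
  have Nu : N n * u = y%:R by rewrite mulrC divfK // gt_eqF.
  have lE : (n - y)%:R = N n * (1 - u) :> R by rewrite natrB // mulrBr mulr1 Nu.
  move: lb; rewrite -(ler_nat R) !natrM => lb.
  rewrite ge_max ler0n /=.
  have l1 : (n - y)%:R - 1 <= (n - y).-1%:R :> R.
    by case: (n - y)%N => [|j] /=; rewrite ?sub0r ?oppr_le0 // -natr1 addrK.
  have ql : N n * Z u <= (n - y)%:R by rewrite lE ler_pM2l // Z_le.
  have zf : N n * Z u <= N n * (1 - yf) by rewrite ler_pM2l // -Z_end Z_mono.
  have Xq : N n ^+ 2 * (2 * X u - u) =
      if 2 * Z u <= 1 - u then (N n * Z u) ^+ 2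
      else 2 * (N n * Z u) * (n - y)%:R - (N n * Z u) ^+ 2 - (n - y)%:R ^+ 2 / 2.
    by case: leP => [/(X_small _ uu) ->|/ltW/(X_large _ uu) ->]; rewrite ?lE; ring.
  have q0 : 0 <= N n * Z u by rewrite mulr_ge0 // Z_ge0.
  have q2 : (2 * Z u <= 1 - u) = (2 * (N n * Z u) <= (n - y)%:R).
    by rewrite lE mulrCA ler_pM2l.
  move: bG; rewrite /budget -/u Xq q2.
  have lN : (n - y)%:R <= N n by rewrite ler_nat leq_subr.
  rewrite -Nu; move: zf lE; rewrite mulrBr mulr1 => zf lE.
  have l0 : 0 <= (n - y)%:R :> R by [].
  have {}lb : (n - y)%:R * ((n - y)%:R - 1) <= 2 * b%:R :> R.
    by apply: le_trans lb; rewrite ler_wpM2l.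
  move: (N n * Z u) (n - y)%:R lE q0 ql zf lN l0 lb => q l lE q0 ql zf lN l0 lb bG.
  suff : l - q <= S by rewrite mulrBr mulr1 in lE; lra.
  (* A full triangle gives l (l - 1) <= 2 b. If 2 q > l this yields 2 (l - q)^2 <= l + 4 q <= 5 n;
     otherwise l^2 / 2 <= l^2 - 2 q^2 <= 5 n, whence the constant 10. *)
  rewrite -ler_sqr ?nnegrE ?subr_ge0 //; apply: le_trans NS.
  case: (leP (2 * q) l) bG => lq bG.
    have H1 : 0 <= q * (l - 2 * q) by rewrite mulr_ge0 // subr_ge0.
    have H2 : 0 <= l * (l - 2 * q) by rewrite mulr_ge0 // subr_ge0.
    have H3 : 0 <= q * (2 * l - q) by rewrite mulr_ge0 //; lra.
    by lra.
  by lra.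
- by rewrite le_max lexx.
- by rewrite ge_max mulr_ge0 // gerBl S0.
- by rewrite ge_max NN0 (le_trans _ Nf) // gerBl.
rewrite /budget mul0r subr0 addr_ge0 // !mulr_ge0 // ?exprn_ge0 //.
by rewrite Z_ge0 // lexx.
Qed.

End Profile.

(** * The two phases *)

Definition C1on {R : realType} (a b : R) (f df : R -> R) : Prop :=
  {within `[a, b], continuous f} /\
  forall x, a < x < b -> is_derive x 1 f (df x).

Section C1on.
Context {R : realType}.
Implicit Types (a b c d x : R) (f g df dg h dh : R -> R).

Lemma C1on_id a b : C1on a b id (fun=> 1).
Proof.
split; first by apply/continuous_subspaceT => x; exact: cvg_id.
by move=> x _; exact: is_derive_id.
Qed.

Lemma C1on_cst a b c : C1on a b (fun=> c) (fun=> 0).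
Proof.
split; first by apply/continuous_subspaceT => x; exact: cvg_cst.
by move=> x _; exact: is_derive_cst.
Qed.

Lemma C1on_add a b f g df dg : C1on a b f df -> C1on a b g dg ->
  C1on a b (fun x => f x + g x) (fun x => df x + dg x).
Proof.
move=> [cf Df] [cg Dg]; split=> [x|x xab]; first by apply: cvgD; [exact: cf|exact: cg].
by apply: is_deriveD; [exact: Df|exact: Dg].
Qed.

Lemma C1on_mul a b f g df dg : C1on a b f df -> C1on a b g dg ->
  C1on a b (fun x => f x * g x) (fun x => f x * dg x + g x * df x).
Proof.
move=> [cf Df] [cg Dg]; split=> [x|x xab]; first by apply: cvgM; [exact: cf|exact: cg].
by apply: is_deriveM; [exact: Df|exact: Dg].
Qed.

Lemma C1on_comp a b h dh f df : (forall x, is_derive x 1 h (dh x)) ->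
  C1on a b f df -> C1on a b (fun x => h (f x)) (fun x => dh (f x) * df x).
Proof.
move=> Dh [cf Df]; split=> [x|x xab].
  apply: cvg_comp; first exact: cf.
  have dh' : derivable h (f x) 1 by have [] := Dh (f x).
  by move/derivable1_diffP : dh' => /differentiable_continuous.
have H := is_derive1_comp (Dh (f x)) (Df x xab).
by apply: is_derive_eq H _; rewrite mulrC.
Qed.

Lemma C1on_inv a b f df : (forall x, a <= x <= b -> f x != 0) ->
  C1on a b f df -> C1on a b (fun x => (f x)^-1) (fun x => - (f x) ^- 2 * df x).
Proof.
move=> f0 [cf Df]; split.
  rewrite continuous_subspace_in => x; rewrite inE /= in_itv /= => xab.
  by apply: cvgV; [exact: f0|exact: cf].
move=> x xab; have fx : f x != 0.
  by apply: f0; case/andP: xab => /ltW -> /ltW ->.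
have [df' E] := Df x xab.
by apply: DeriveDef; [exact: derivableV | rewrite deriveV // E].
Qed.

Lemma C1on_eq a b f df dg : (forall x, a < x < b -> df x = dg x) ->
  C1on a b f df -> C1on a b f dg.
Proof. by move=> E [cf Df]; split=> // x xab; rewrite -E //; exact: Df. Qed.

Lemma C1on_sub a b c d f df : a <= c -> d <= b -> C1on a b f df -> C1on c d f df.
Proof.
move=> ac db [cf Df]; split.
  apply: continuous_subspaceW cf => x /=; rewrite !in_itv /= => /andP[cx xd].
  by rewrite (le_trans ac) // (le_trans xd).
by move=> x /andP[cx xd]; apply: Df; rewrite (le_lt_trans ac) // (lt_le_trans xd).
Qed.

Lemma C1on_exp a b f df (k : nat) : C1on a b f df ->
  C1on a b (fun x => f x ^+ k) (fun x => k%:R * f x ^+ k.-1 * df x).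
Proof.
move=> Cf; elim: k => [|k IH].
  by apply: C1on_eq (C1on_cst a b 1) => x _; rewrite !mul0r.
have -> : (fun x => f x ^+ k.+1) = (fun x => f x * f x ^+ k).
  by apply/funext => x; rewrite exprS.
apply: C1on_eq (C1on_mul _ _ _ _ _ _ Cf IH) => x _; case: k {IH} => [|k] /=.
  by rewrite !expr0 !mul0r mulr0 add0r !mul1r.
by rewrite -(natr1 k.+1) exprS; ring.
Qed.

Lemma C1on_MVT a b f df : a < b -> C1on a b f df ->
  exists2 c, a < c < b & f b - f a = df c * (b - a).
Proof.
move=> ab [cf Df].
have D x : x \in `]a, b[%R -> is_derive x 1 f (df x) by rewrite in_itv /= => /Df.
by have [c] := MVT ab D cf; rewrite in_itv /=; exists c.
Qed.

Lemma C1on_le a b f df x y : C1on a b f df ->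
  (forall t, a < t < b -> 0 <= df t) -> a <= x -> x <= y -> y <= b -> f x <= f y.
Proof.
move=> fab df0 ax; rewrite le_eqVlt => /predU1P[-> //|xy] yb.
have [c /andP[xc cy] E] := C1on_MVT _ _ _ _ xy (C1on_sub _ _ _ _ _ _ ax yb fab).
rewrite -subr_ge0 E mulr_ge0 ?subr_ge0 ?(ltW xy) // df0 //.
by rewrite (le_lt_trans ax) // (lt_le_trans cy).
Qed.

Lemma C1on_lt a b f df x y : C1on a b f df ->
  (forall t, a < t < b -> 0 < df t) -> a <= x -> x < y -> y <= b -> f x < f y.
Proof.
move=> fab df0 ax xy yb.
have [c /andP[xc cy] E] := C1on_MVT _ _ _ _ xy (C1on_sub _ _ _ _ _ _ ax yb fab).
rewrite -subr_gt0 E mulr_gt0 ?subr_gt0 // df0 //.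
by rewrite (le_lt_trans ax) // (lt_le_trans cy).
Qed.

Lemma C1on_const a b f df x : C1on a b f df ->
  (forall t, a < t < b -> df t = 0) -> a <= x -> x <= b -> f x = f a.
Proof.
move=> fab df0; rewrite le_eqVlt => /predU1P[-> //|ax] xb.
have [c /andP[xc cy] E] := C1on_MVT _ _ _ _ ax (C1on_sub _ _ _ _ _ _ (lexx a) xb fab).
by apply/eqP; rewrite -subr_eq0 E df0 ?mul0r // xc (lt_le_trans cy).
Qed.

Lemma within_pos a b f : {within `[a, b], continuous f} ->
  (forall x, a < x < b -> f x != 0) -> (exists2 x0, a <= x0 < b & 0 < f x0) ->
  forall x, a < x < b -> 0 < f x.
Proof.
move=> cf f0 [x0 /andP[ax0 x0b] fx0] x /andP[ax xb].
rewrite ltNge; apply/negP => fx.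
(* The zero given by the intermediate value theorem has to avoid [a], where [f] may vanish; this is
   the purpose of the last premise. *)
have key u v : a <= u -> v < b -> u <= v -> 
    Num.min (f u) (f v) <= 0 <= Num.max (f u) (f v) -> f u != 0 \/ a < u -> False.
  move=> au vb uv /(IVT uv) H fu0.
  have [|c] := H.
    apply: continuous_subspaceW cf => t /=; rewrite !in_itv /= => /andP[ut tv].
    by rewrite (le_trans au) // (le_trans tv) // ltW.
  rewrite in_itv /= => /andP[uc cv] fc.
  case: fu0 => [fu0|au'].
    have uc' : u < c by rewrite lt_neqAle uc andbT; apply: contraNneq fu0 => ->; apply/eqP.
    by move: (f0 c); rewrite fc eqxx (le_lt_trans au) // (le_lt_trans cv) // => /(_ isT).
  by move: (f0 c); rewrite fc eqxx (lt_le_trans au') // (le_lt_trans cv) // => /(_ isT).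
have [x0x|xx0] := leP x0 x.
  apply: (key _ _ ax0 xb x0x).
    by rewrite ge_min le_max fx orbT (ltW fx0).
  by left; rewrite gt_eqF.
apply: (key _ _ (ltW ax) x0b (ltW xx0)).
  by rewrite ge_min le_max fx (ltW fx0) orbT.
by right.
Qed.

End C1on.

Lemma C1on_expR {R : realType} (a b : R) (f df : R -> R) : C1on a b f df ->
  C1on a b (fun x => expR (f x)) (fun x => expR (f x) * df x).
Proof. by apply: C1on_comp => x; exact: is_derive_expR. Qed.

(** The mean value theorem for dy/dx = 1 / (1 - z), with z at the mean point replaced by its upper
    bound [z x']. *)
Lemma speed_bound {R : realType} (a b : R) (y z : R -> R) (x x' : R) :
  C1on a b y (fun t => 1 / (1 - z t)) ->
  (forall t, a < t < b -> 0 < 1 - z t) ->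
  (forall s t, a <= s -> s <= t -> t <= b -> z s <= z t) ->
  a <= x -> x <= x' -> x' <= b ->
  (1 - z x') * (y x' - y x) <= x' - x.
Proof.
move=> Cy z1 zm ax; rewrite le_eqVlt => /predU1P[->|xx'] x'b.
  by rewrite !subrr mulr0.
have [c /andP[xc cx'] ->] := C1on_MVT _ _ _ _ xx' (C1on_sub _ _ _ _ _ _ ax x'b Cy).
rewrite mulrA ger_pMl ?subr_gt0 // mul1r ler_pdivrMr ?mul1r.
  by rewrite lerD2l lerN2; apply: zm => //; [exact: le_trans ax (ltW xc)|exact: ltW].
by rewrite z1 // (le_lt_trans ax) // (lt_le_trans cx').
Qed.

(** * First phase: the square fits under the triangle *)

Section Phase1.
Context {R : realType} (y z : R -> R) (b : R).
Hypothesis h1 : phase1 y z b.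

Lemma phase1_C1 : [/\ 0 < b, C1on 0 b y (fun x => 1 / (1 - z x)) &
  C1on 0 b z (fun x => 1 / (2 * z x) - 1 / (2 * (1 - z x)))].
Proof.
have [b0 [cy [cz [_ [_ [D _]]]]]] := h1.
by split=> //; split=> // x /D[_ [_ []]].
Qed.

Lemma phase1_neq0 x : 0 < x < b -> z x != 0 /\ 1 - z x != 0.
Proof. by have [_ [_ [_ [_ [_ [D _]]]]]] := h1; move=> /D[? []]. Qed.

Lemma phase1_ends : [/\ y 0 = 0, z 0 = 0 & y b + 2 * z b = 1].
Proof. by have [_ [_ [_ [? [? [_ ?]]]]]] := h1. Qed.

Lemma phase1_touched :
  C1on 0 b (fun x => y x + 2 * z x) (fun x => 1 / z x).
Proof.
have [b0 Cy Cz] := phase1_C1.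
apply: C1on_eq (C1on_add _ _ _ _ _ _ Cy (C1on_mul _ _ _ _ _ _ (C1on_cst 0 b 2) Cz)).
by move=> x /phase1_neq0[z0 z1]; field; rewrite z0 z1.
Qed.

(** As y + 2z climbs from 0 to 1 with slope 1 / z, some point has z > 0; z never vanishes inside, so
    its sign is fixed. *)
Lemma phase1_z_gt0 x : 0 < x < b -> 0 < z x.
Proof.
have [b0 Cy [cz Dz]] := phase1_C1; have [y0 z0 yz] := phase1_ends.
apply: within_pos => // [t /phase1_neq0[]//|].
have [c cb E] := C1on_MVT _ _ _ _ b0 phase1_touched.
exists c; first by case/andP: cb => /ltW -> ->.
move: E; rewrite yz y0 z0 mulr0 !subr0 => E.
have : 0 < 1 / z c * b by rewrite -E.
by rewrite pmulr_lgt0 // div1r invr_gt0.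
Qed.

Lemma phase1_1z_gt0 x : 0 < x < b -> 0 < 1 - z x.
Proof.
have [b0 Cy Cz] := phase1_C1; have [y0 z0 yz] := phase1_ends.
apply: (@within_pos _ _ _ (fun t => 1 - z t)).
- have [H _] := C1on_add _ _ _ _ _ _ (C1on_cst 0 b 1)
    (C1on_mul _ _ _ _ _ _ (C1on_cst 0 b (- 1)) Cz).
  by move: H; under [X in {within _, continuous X}]eq_fun do rewrite mulN1r.
- by move=> t /phase1_neq0[].
- by exists 0; rewrite ?lexx // z0 subr0.
Qed.

(** The derivative of y + z^2 is 2. Geometrically, the covered area 2x - y is the whole square of
    side z. *)
Lemma phase1_energy x : 0 <= x <= b -> y x + z x ^+ 2 = 2 * x.
Proof.
have [b0 Cy Cz] := phase1_C1; have [y0 z0 yz] := phase1_ends.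
have C := C1on_add _ _ _ _ _ _ (C1on_add _ _ _ _ _ _ Cy (C1on_mul _ _ _ _ _ _ Cz Cz))
  (C1on_mul _ _ _ _ _ _ (C1on_cst 0 b (- 2)) (C1on_id 0 b)).
move=> /andP[x0 xb]; have := C1on_const _ _ _ _ _ C _ x0 xb.
rewrite y0 z0 => H; suff : y x + z x * z x + -2 * x = 0 by rewrite expr2; lra.
rewrite H; first by rewrite !mulr0 !addr0.
by move=> t /phase1_neq0[zt zt1]; field; rewrite zt zt1.
Qed.

(** The logarithmic derivative of 1 - 2z is -1 / (z (1 - z)), the opposite of that of the
    exponential. This also forces z < 1/2, and hence the monotonicity of z. *)
Lemma phase1_exp x : 0 <= x <= b ->
  (1 - 2 * z x) * expR (2 * (y x + z x)) = 1.
Proof.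
have [b0 Cy Cz] := phase1_C1; have [y0 z0 yz] := phase1_ends.
have C1 := C1on_add _ _ _ _ _ _ (C1on_cst 0 b 1)
  (C1on_mul _ _ _ _ _ _ (C1on_cst 0 b (- 2)) Cz).
have C2 := C1on_expR _ _ _ _ (C1on_mul _ _ _ _ _ _ (C1on_cst 0 b 2)
  (C1on_add _ _ _ _ _ _ Cy Cz)).
have C := C1on_mul _ _ _ _ _ _ C1 C2.
move=> /andP[x0 xb]; have := C1on_const _ _ _ _ _ C _ x0 xb.
rewrite y0 z0 !addr0 !mulr0 addr0 expR0 mulr1 -mulNr => -> //.
by move=> t /phase1_neq0[zt zt1]; field; rewrite zt zt1.
Qed.

Lemma phase1_z_lt_half x : 0 <= x <= b -> z x < 1 / 2.
Proof.
move=> /phase1_exp E; have : 0 < (1 - 2 * z x) * expR (2 * (y x + z x)) by rewrite E.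
by rewrite pmulr_lgt0 ?expR_gt0 //; lra.
Qed.

Lemma phase1_z_le s t : 0 <= s -> s <= t -> t <= b -> z s <= z t.
Proof.
have [b0 Cy Cz] := phase1_C1; apply: (C1on_le _ _ _ _ _ _ Cz) => x xb.
have z0 := phase1_z_gt0 x xb; have z1 := phase1_1z_gt0 x xb.
have zh : z x < 1 / 2 by apply: phase1_z_lt_half; case/andP: xb => /ltW -> /ltW ->.
rewrite subr_ge0 !div1r lef_pV2 ?posrE ?mulr_gt0 //.
by rewrite ler_pM2l //; lra.
Qed.

Lemma phase1_y_lt s t : 0 <= s -> s < t -> t <= b -> y s < y t.
Proof.
have [b0 Cy Cz] := phase1_C1; apply: (C1on_lt _ _ _ _ _ _ Cy) => x xb.
by rewrite div1r invr_gt0 phase1_1z_gt0.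
Qed.

Lemma phase1_touched_le x : 0 <= x <= b -> y x + 2 * z x <= 1.
Proof.
move=> /andP[x0 xb]; have [_ _ E] := phase1_ends; rewrite -[leRHS]E.
have H := C1on_le _ _ _ _ x b phase1_touched; apply: H => // t tb.
by rewrite div1r invr_ge0 ltW // phase1_z_gt0.
Qed.

Lemma phase1_speed x x' : 0 <= x -> x <= x' -> x' <= b ->
  (1 - z x') * (y x' - y x) <= x' - x.
Proof.
have [b0 Cy Cz] := phase1_C1.
by apply: speed_bound => //; [exact: phase1_1z_gt0|exact: phase1_z_le].
Qed.

End Phase1.

(** * Second phase: the corner of the square sticks out of the triangle *)

Section Phase2.
Context {R : realType} (y1 z1 y z : R -> R) (a b : R).
Hypothesis h2 : phase2 y1 z1 y z a b.
Hypotheses (y1_gt0 : 0 < y1 a) (z1_gt0 : 0 < z1 a) (yz1 : y1 a + 2 * z1 a = 1).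

Lemma phase2_C1 : [/\ a < b, C1on a b y (fun x => 1 / (1 - z x)) &
  C1on a b z (fun x => 1 / (2 * (1 - y x - z x)) - 1 / (2 * (1 - z x)))].
Proof.
have [ab [cy [cz [_ [_ [D _]]]]]] := h2.
by split=> //; split=> // x /D[_ [_ []]].
Qed.

Lemma phase2_neq0 x : a < x < b -> 1 - y x - z x != 0 /\ 1 - z x != 0.
Proof. by have [_ [_ [_ [_ [_ [D _]]]]]] := h2; move=> /D[? []]. Qed.

Lemma phase2_ends : [/\ y a = y1 a, z a = z1 a & y b + z b = 1].
Proof. by have [_ [_ [_ [? [? [_ ?]]]]]] := h2. Qed.

Lemma phase2_C1_gap : C1on a b (fun x => 1 - y x - z x)
  (fun x => - (1 / (1 - z x)) - (1 / (2 * (1 - y x - z x)) - 1 / (2 * (1 - z x)))).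
Proof.
have [_ Cy Cz] := phase2_C1.
have [H1 H2] := C1on_add _ _ _ _ _ _ (C1on_add _ _ _ _ _ _ (C1on_cst a b 1)
  (C1on_mul _ _ _ _ _ _ (C1on_cst a b (- 1)) Cy))
  (C1on_mul _ _ _ _ _ _ (C1on_cst a b (- 1)) Cz).
have E : (fun x => 1 + -1 * y x + -1 * z x) = (fun x => 1 - y x - z x).
  by apply/funext => x; rewrite !mulN1r.
rewrite E in H1 H2; split=> // x /H2 H; apply: is_derive_eq H _.
by rewrite !mulr0 !addr0 !mulN1r add0r.
Qed.

Lemma phase2_C1_1z : C1on a b (fun x => 1 - z x)
  (fun x => - (1 / (2 * (1 - y x - z x)) - 1 / (2 * (1 - z x)))).
Proof.
have [_ Cy Cz] := phase2_C1.
have [H1 H2] := C1on_add _ _ _ _ _ _ (C1on_cst a b 1)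
  (C1on_mul _ _ _ _ _ _ (C1on_cst a b (- 1)) Cz).
have E : (fun x => 1 + -1 * z x) = (fun x => 1 - z x).
  by apply/funext => x; rewrite mulN1r.
rewrite E in H1 H2; split=> // x /H2 H; apply: is_derive_eq H _.
by rewrite !mulr0 !addr0 !mulN1r add0r.
Qed.

Lemma phase2_gap_gt0 x : a < x < b -> 0 < 1 - y x - z x.
Proof.
have [ab _ _] := phase2_C1; have [ya za _] := phase2_ends.
have [cM _] := phase2_C1_gap.
apply: (@within_pos _ _ _ (fun t => 1 - y t - z t)) => //.
  by move=> t /phase2_neq0[].
by exists a; [rewrite lexx|rewrite /= ya za; move: z1_gt0 yz1; lra].
Qed.

Lemma phase2_1z_gt0 x : a < x < b -> 0 < 1 - z x.
Proof.
have [ab _ _] := phase2_C1; have [ya za _] := phase2_ends.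
have [cM _] := phase2_C1_1z.
apply: (@within_pos _ _ _ (fun t => 1 - z t)) => //.
  by move=> t /phase2_neq0[].
by exists a; [rewrite lexx|rewrite /= za; move: y1_gt0 yz1; lra].
Qed.

Lemma phase2_y_lt s t : a <= s -> s < t -> t <= b -> y s < y t.
Proof.
have [_ Cy _] := phase2_C1; apply: (C1on_lt _ _ _ _ _ _ Cy) => x xb.
by rewrite div1r invr_gt0 phase2_1z_gt0.
Qed.

Lemma phase2_y_gt0 x : a <= x <= b -> 0 < y x.
Proof.
have [ya _ _] := phase2_ends.
move=> /andP[]; rewrite le_eqVlt => /predU1P[<- _|ax xb]; first by rewrite ya.
by apply: (lt_trans y1_gt0); rewrite -ya phase2_y_lt.
Qed.

Lemma phase2_z_le s t : a <= s -> s <= t -> t <= b -> z s <= z t.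
Proof.
have [_ _ Cz] := phase2_C1; apply: (C1on_le _ _ _ _ _ _ Cz) => x xb.
have M0 := phase2_gap_gt0 x xb; have s0 := phase2_1z_gt0 x xb.
have y0 : 0 < y x by apply: phase2_y_gt0; case/andP: xb => /ltW -> /ltW ->.
rewrite subr_ge0 !div1r lef_pV2 ?posrE ?mulr_gt0 //.
by rewrite ler_pM2l //; lra.
Qed.

Lemma phase2_gap_ge0 x : a <= x <= b -> 0 <= 1 - y x - z x.
Proof.
have [ya za yzb] := phase2_ends.
move=> /andP[]; rewrite le_eqVlt => /predU1P[<- _|ax]; first by rewrite ya za; move: z1_gt0 yz1; lra.
rewrite le_eqVlt => /predU1P[->|xb]; first by lra.
by rewrite ltW // phase2_gap_gt0 // ax.
Qed.

Lemma phase2_touched_ge x : a <= x <= b -> 1 <= y x + 2 * z x.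
Proof.
have [_ Cy Cz] := phase2_C1; have [ya za _] := phase2_ends.
move=> /andP[ax xb].
have C : C1on a b (fun x => y x + 2 * z x) (fun x => 1 / (1 - y x - z x)).
  apply: C1on_eq (C1on_add _ _ _ _ _ _ Cy (C1on_mul _ _ _ _ _ _ (C1on_cst a b 2) Cz)).
  by move=> t /phase2_neq0[zt zt1]; field; apply/andP; split.
rewrite -[leLHS]yz1 -ya -za.
have H := C1on_le _ _ _ _ a x C; apply: H => // t tb.
by rewrite divr_ge0 // ltW // phase2_gap_gt0.
Qed.

(** A conserved quantity: the right-hand side is z^2 - (2z - (1 - y))^2 / 2, the square without its
    protruding corner. *)
Lemma phase2_energy x : a <= x <= b -> 2 * a = y1 a + z1 a ^+ 2 ->
  2 * x - y x = 2 * z x * (1 - y x) - z x ^+ 2 - (1 - y x) ^+ 2 / 2.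
Proof.
have [_ Cy Cz] := phase2_C1; have [ya za _] := phase2_ends.
move=> /andP[ax xb] a2.
have C := C1on_add _ _ _ _ _ _ (C1on_mul _ _ _ _ _ _ (C1on_cst a b 2) (C1on_id a b))
  (C1on_add _ _ _ _ _ _ (C1on_mul _ _ _ _ _ _ (C1on_cst a b (- 2)) Cy)
  (C1on_add _ _ _ _ _ _ (C1on_mul _ _ _ _ _ _ (C1on_cst a b (- 2)) Cz)
  (C1on_add _ _ _ _ _ _
    (C1on_mul _ _ _ _ _ _ (C1on_mul _ _ _ _ _ _ (C1on_cst a b 2) Cz) Cy)
  (C1on_add _ _ _ _ _ _ (C1on_mul _ _ _ _ _ _ Cz Cz)
    (C1on_mul _ _ _ _ _ _ (C1on_cst a b (1 / 2)) (C1on_mul _ _ _ _ _ _ Cy Cy)))))).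
have := C1on_const _ _ _ _ _ C _ ax xb.
rewrite ya za => H; have {}H := H _.
suff E : 2 * x + (-2 * y x + (-2 * z x + (2 * z x * y x + (z x * z x + 1 / 2 * (y x * y x)))))
    = - (1 / 2) by rewrite !expr2; lra.
rewrite H; last by move=> t /phase2_neq0[zt zt1]; field; apply/andP; split.
rewrite a2.
have -> : y1 a = 1 - 2 * z1 a by move: yz1; lra.
by field.
Qed.

Lemma phase2_speed x x' : a <= x -> x <= x' -> x' <= b ->
  (1 - z x') * (y x' - y x) <= x' - x.
Proof.
have [_ Cy Cz] := phase2_C1.
by apply: speed_bound => //; [exact: phase2_1z_gt0|exact: phase2_z_le].
Qed.

(* With s = 1 - z and M = 1 - y - z the equations become ds/dM = (s-M)/(s+M),
   whose solutions are logarithmic spirals. *)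
Lemma phase2_spiral :
  y b ^+ 2 = ((1 - z1 a) ^+ 2 + z1 a ^+ 2) * expR (- 2 * atan (z1 a / (1 - z1 a))).
Proof.
have [ab Cy Cz] := phase2_C1; have [ya za yzb] := phase2_ends.
(* The quotient M / s must be continuous at the end points too; z is monotone and ends at 1 - [y b]
   < 1. *)
have s0 t : a <= t <= b -> 1 - z t != 0.
  move=> /andP[at_ tb]; rewrite gt_eqF //.
  have := phase2_z_le _ _ at_ tb (lexx b).
  by have := phase2_y_gt0 b; rewrite lexx (ltW ab) => /(_ isT); lra.
have Cs := phase2_C1_1z; have CM := phase2_C1_gap.
have C1 := C1on_add _ _ _ _ _ _ (C1on_mul _ _ _ _ _ _ Cs Cs) (C1on_mul _ _ _ _ _ _ CM CM).
have C2 := C1on_comp _ _ _ _ _ _ (fun x => is_derive1_atan x)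
  (C1on_mul _ _ _ _ _ _ CM (C1on_inv _ _ _ _ s0 Cs)).
have C3 := C1on_expR _ _ _ _ (C1on_mul _ _ _ _ _ _ (C1on_cst a b (- 2)) C2).
have := C1on_const _ _ _ _ _ (C1on_mul _ _ _ _ _ _ C1 C3) _ (ltW ab) (lexx b).
move=> H; have {}H := H _.
have -> : y b ^+ 2 = ((1 - z b) * (1 - z b) + (1 - y b - z b) * (1 - y b - z b)) *
    expR (-2 * atan ((1 - y b - z b) / (1 - z b))).
  have -> : 1 - y b - z b = 0 by lra.
  by rewrite !mul0r atan0 !mulr0 expR0 addr0 mulr1 -expr2; congr (_ ^+ 2); lra.
rewrite H ?ya ?za.
  by have -> : 1 - y1 a - z1 a = z1 a by move: yz1; lra.
move=> t tb; have [M0 z0] := phase2_neq0 t tb.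
set e := expR _; move: e => e; set w := atan _; move: w => w.
move: (1 - z t) (1 - y t - z t) M0 z0 => s M M0 s0'.
have SM : s ^+ 2 + M ^+ 2 != 0.
  by rewrite gt_eqF // ltr_wpDr ?sqr_ge0 // exprn_even_gt0.
have -> : (1 + (M / s) ^+ 2)^-1 = s ^+ 2 / (s ^+ 2 + M ^+ 2).
  rewrite -[RHS]invrK invf_div; congr (_^-1).
  by field.
by field; rewrite ?M0 ?s0' ?SM.
Qed.

End Phase2.

(** * Numerical value *)

Section ElementaryBounds.
Context {R : realType}.

Definition exp_neg_sum (k : nat) (x : R) : R := \sum_(i < k) (- x) ^+ i / i`!%:R.

Lemma C1on_exp_neg_sum (k : nat) (a b : R) :
  C1on a b (exp_neg_sum k.+1) (fun x => - exp_neg_sum k x).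
Proof.
elim: k => [|k IH].
  have -> : exp_neg_sum 1 = fun=> 1.
    by apply/funext => x; rewrite /exp_neg_sum big_ord1 expr0 fact0 divr1.
  apply: C1on_eq (C1on_cst a b 1) => x _.
  by rewrite /exp_neg_sum big_ord0 oppr0.
have -> : exp_neg_sum k.+2 =
    fun x => exp_neg_sum k.+1 x + (k.+1`!%:R)^-1 * (- x) ^+ k.+1.
  by apply/funext => x; rewrite [LHS]big_ord_recr /= mulrC.
have CN : C1on a b (fun t : R => - t) (fun=> - 1).
  have -> : (fun t : R => - t) = (fun t => - 1 * t) by apply/funext => t; rewrite mulN1r.
  apply: C1on_eq (C1on_mul _ _ _ _ _ _ (C1on_cst a b (- 1)) (C1on_id a b)) => t _.
  by rewrite mulr1 mulr0 addr0.
have CX := C1on_exp _ _ _ _ k.+1 CN.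
apply: C1on_eq (C1on_add _ _ _ _ _ _ IH (C1on_mul _ _ _ _ _ _ (C1on_cst a b _) CX)).
move=> x _; rewrite mulr0 addr0 [in RHS]/exp_neg_sum big_ord_recr /= opprD; congr (_ + _).
rewrite mulrN1 mulrN; congr (- _); rewrite factS natrM invfM /=; field.
by rewrite nat1r !pnatr_eq0 -lt0n fact_gt0.
Qed.

(** The Taylor sum ends with a negative term. Its product with exp(t) decreases from 1, the
    derivative being exp(t) (-t)^k / k! <= 0 for odd [k]. *)
Lemma exp_neg_sum_le (k : nat) (x : R) : odd k -> 0 <= x ->
  exp_neg_sum k.+1 x <= expR (- x).
Proof.
move=> ok x0; rewrite expRN -[_^-1]mul1r ler_pdivlMr ?expR_gt0 //.
have C := C1on_mul _ _ _ _ _ _ (C1on_mul _ _ _ _ _ _ (C1on_cst 0 x (- 1))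
   (C1on_exp_neg_sum k 0 x)) (C1on_expR _ _ _ _ (C1on_id 0 x)).
have := C1on_le _ _ _ _ 0 x C _ (lexx 0) x0 (lexx x).
rewrite !mulN1r !mulNr lerN2 expR0 mulr1.
have -> : exp_neg_sum k.+1 0 = 1.
  rewrite /exp_neg_sum big_ord_recl big1 ?addr0 => [|i _].
    by rewrite expr0 fact0 divr1.
  by rewrite oppr0 expr0n mul0r.
apply => t /andP[t0 _] /=; rewrite mulr1 mulr0 addr0.
rewrite (_ : _ + _ = expR t * (exp_neg_sum k t - exp_neg_sum k.+1 t)); last by ring.
rewrite mulr_ge0 ?expR_ge0 // [X in _ - X]big_ord_recr opprD addNKr /=.
rewrite -mulNr mulr_ge0 ?invr_ge0 //.
by rewrite exprNn -signr_odd ok expr1 mulN1r opprK exprn_ge0 // ltW.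
Qed.

Definition atan_sum (k : nat) (x : R) : R :=
  \sum_(i < k) (- 1) ^+ i * x ^+ i.*2.+1 / i.*2.+1%:R.

Lemma C1on_atan_sum (k : nat) (a b : R) :
  C1on a b (atan_sum k) (fun x => \sum_(i < k) (- x ^+ 2) ^+ i).
Proof.
elim: k => [|k IH].
  have -> : atan_sum 0 = fun=> 0 by apply/funext => x; rewrite /atan_sum big_ord0.
  by apply: C1on_eq (C1on_cst a b 0) => x _; rewrite big_ord0.
have -> : atan_sum k.+1 =
    fun x => atan_sum k x + (- 1) ^+ k / k.*2.+1%:R * x ^+ k.*2.+1.
  by apply/funext => x; rewrite [LHS]big_ord_recr /= mulrAC.
have CX := C1on_exp _ _ _ _ k.*2.+1 (C1on_id a b).
apply: C1on_eq (C1on_add _ _ _ _ _ _ IH (C1on_mul _ _ _ _ _ _ (C1on_cst a b _) CX)).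
move=> x _; rewrite mulr0 addr0 big_ord_recr /=; congr (_ + _).
by rewrite mulr1 [in RHS]exprNn -exprM mul2n mulrA divfK.
Qed.

(** For odd [k] the geometric sum in the derivative equals (1 + t^(2k)) / (1 + t^2), which is at
    least 1 / (1 + t^2). *)
Lemma atan_le_sum (k : nat) (x : R) : odd k -> 0 <= x -> atan x <= atan_sum k x.
Proof.
move=> ok x0; rewrite -subr_ge0 addrC -mulN1r.
have Catan : C1on 0 x atan (fun t => (1 + t ^+ 2)^-1).
  split=> [|t _]; last exact: is_derive1_atan.
  by apply: continuous_subspaceT => t; exact: continuous_atan.
have C := C1on_add _ _ _ _ _ _ (C1on_mul _ _ _ _ _ _ (C1on_cst 0 x (- 1)) Catan)
   (C1on_atan_sum k 0 x).
have := C1on_le _ _ _ _ 0 x C _ (lexx 0) x0 (lexx x).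
rewrite atan0 mulr0 add0r.
have -> : atan_sum k 0 = 0.
  by rewrite /atan_sum big1 // => i _; rewrite expr0n mulr0 mul0r.
apply => t _ /=; rewrite mulr0 addr0 mulN1r.
have p : 0 < 1 + t ^+ 2 by rewrite ltr_pwDl // sqr_ge0.
rewrite addrC subr_ge0 -[leLHS]mul1r ler_pdivrMr //.
have := subrX1 (- t ^+ 2) k.
rewrite exprNn -exprM -signr_odd ok expr1 mulN1r => E.
have : 0 <= t ^+ (2 * k) by rewrite exprM exprn_ge0 // sqr_ge0.
by move: (\sum_(i < k) _) E => S; lra.
Qed.

End ElementaryBounds.

(** Dividing the argument by 8 makes six Taylor terms accurate enough; [q] is a rounded decimal that
    keeps the arithmetic small. *)
Lemma expR_lower8 {R : realType} (q x : R) : 0 <= x -> 0 <= q ->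
  q <= exp_neg_sum 6 (x / 8) -> q ^+ 8 <= expR (- x).
Proof.
move=> x0 q0 qx.
have -> : - x = 8%:R * - (x / 8) by field.
rewrite expRM_natl lerXn2r ?nnegrE ?expR_ge0 //.
by apply: le_trans qx _; apply: exp_neg_sum_le; rewrite ?divr_ge0.
Qed.

(* The margin is small: 241 / 1250 = 0.1928, the exact value is 0.1928019... *)
Lemma spiral_end_bound {R : realType} (z : R) : 0 < z < 1 / 2 ->
  (1 - 2 * z) * expR (2 * (1 - z)) = 1 ->
  241 / 1250 < ((1 - z) ^+ 2 + z ^+ 2) * expR (- 2 * atan (z / (1 - z))).
Proof.
move=> /andP[z0 zh] E.
(* Powers of [k] write decimals in blocks of three digits: [zeta] is 0.360768, just above the root
   z. *)
pose k : R := 1000^-1.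
pose zeta : R := 360 * k + 768 * k ^+ 2.
have zz : z <= zeta.
  (* In exp(-2 (1 - z)) = 1 - 2z the left side increases with z and the right side decreases, so z >
     [zeta] would contradict the values at [zeta]. *)
  rewrite leNgt; apply/negP => zlt.
  have E' : expR (- (2 * (1 - z))) = 1 - 2 * z.
    have e0 : expR (2 * (1 - z)) != 0 by rewrite gt_eqF // expR_gt0.
    by apply: (mulIf e0); rewrite expRN mulVf // E.
  have L : (852 * k + 307 * k ^+ 2 + 300 * k ^+ 3) ^+ 8 <= expR (- (2 * (1 - zeta))).
    apply: expR_lower8; rewrite /zeta /k; [lra|lra|].
    by rewrite /exp_neg_sum !big_ord_recr big_ord0 /= !factS fact0; lra.
  have : expR (- (2 * (1 - zeta))) <= expR (- (2 * (1 - z))) by rewrite ler_expR; lra.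
  by rewrite E'; move: L zlt; rewrite /zeta /k; lra.
have tz : z / (1 - z) <= 564 * k + 378 * k ^+ 2.
  by rewrite ler_pdivrMr; move: zz; rewrite /zeta /k; lra.
have A : atan (z / (1 - z)) <= 513 * k + 816 * k ^+ 2.
  apply: le_trans (_ : atan (564 * k + 378 * k ^+ 2) <= _).
    exact: le_atan.
  have t0 : 0 <= 564 * k + 378 * k ^+ 2 by rewrite /k; lra.
  apply: le_trans (atan_le_sum 9 _ isT t0) _.
  by rewrite /atan_sum !big_ord_recr big_ord0 /= !doubleS double0 /k; lra.
have L : (879 * k + 454 * k ^+ 2) ^+ 8 <= expR (- (2 * (513 * k + 816 * k ^+ 2))).
  apply: expR_lower8; rewrite /k; [lra|lra|].
  by rewrite /exp_neg_sum !big_ord_recr big_ord0 /= !factS fact0; lra.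
have X : (879 * k + 454 * k ^+ 2) ^+ 8 <= expR (- 2 * atan (z / (1 - z))).
  by apply: le_trans L _; rewrite ler_expR; lra.
(* The difference of the two sides is 2 (zeta - z) (1 - z - zeta). *)
have K : (1 - zeta) ^+ 2 + zeta ^+ 2 <= (1 - z) ^+ 2 + z ^+ 2.
  have : 0 <= (zeta - z) * (1 - z - zeta) by rewrite mulr_ge0; move: zz; rewrite /zeta /k; lra.
  by rewrite !expr2; lra.
have q0 : 0 <= (879 * k + 454 * k ^+ 2) ^+ 8 by apply: exprn_ge0; rewrite /k; lra.
have K0 : 0 <= (1 - zeta) ^+ 2 + zeta ^+ 2 by rewrite addr_ge0 ?sqr_ge0.
apply: lt_le_trans (ler_pM K0 q0 K X).
by rewrite /zeta /k; lra.
Qed.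

(** * The bound *)

Section Curve.
Context {R : realType} (y1 z1 y2 z2 : R -> R) (a b : R).
Hypotheses (h1 : phase1 y1 z1 a) (h2 : phase2 y1 z1 y2 z2 a b).

Lemma junction : [/\ 0 < y1 a, 0 < z1 a & y1 a + 2 * z1 a = 1].
Proof.
have [a0 _ _] := phase1_C1 _ _ _ h1; have [y0 z0 yz] := phase1_ends _ _ _ h1.
split=> //; first by rewrite -[ltLHS]y0 (phase1_y_lt _ _ _ h1).
have a2 : 0 < a / 2 < a by lra.
have /andP[a20 a2a] := a2.
apply: lt_le_trans (phase1_z_gt0 _ _ _ h1 _ a2) _.
by apply: (phase1_z_le _ _ _ h1) => //; exact: ltW.
Qed.

Let ya0 : 0 < y1 a. Proof. by have [] := junction. Qed.
Let za0 : 0 < z1 a. Proof. by have [] := junction. Qed.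
Let yza : y1 a + 2 * z1 a = 1. Proof. by have [] := junction. Qed.

(** The glued solution, meant to be read with y = u as parameter; both branches agree at x = [a]. *)
Definition on_curve (x u v : R) : Prop :=
  (0 <= x <= a /\ y1 x = u /\ z1 x = v) \/ (a <= x <= b /\ y2 x = u /\ z2 x = v).

Lemma on_curve_exists (u : R) : 0 <= u <= y2 b -> exists x v, on_curve x u v.
Proof.
have [a0 [cy1 _] _] := phase1_C1 _ _ _ h1; have [y0 _ _] := phase1_ends _ _ _ h1.
have [ab [cy2 _] _] := phase2_C1 _ _ _ _ _ _ h2.
have [ya _ _] := phase2_ends _ _ _ _ _ _ h2.
move=> /andP[u0 ub]; have [ua|/ltW ua] := leP u (y1 a).
  have I : Num.min (y1 0) (y1 a) <= u <= Num.max (y1 0) (y1 a).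
    by rewrite y0 ge_min le_max u0 ua orbT.
  have [x] := IVT (ltW a0) cy1 I.
  by rewrite in_itv /= => xa yx; exists x, (z1 x); left.
have I : Num.min (y2 a) (y2 b) <= u <= Num.max (y2 a) (y2 b).
  by rewrite ya ge_min le_max ua ub orbT.
have [x] := IVT (ltW ab) cy2 I.
by rewrite in_itv /= => xa yx; exists x, (z2 x); right.
Qed.

Lemma on_curve_le (x u v x' u' v' : R) :
  on_curve x u v -> on_curve x' u' v' -> u <= u' ->
  v <= v' /\ (1 - v') * (u' - u) <= x' - x.
Proof.
have [ya za _] := phase2_ends _ _ _ _ _ _ h2.
case=> [[/andP[x0 xa] [<- <-]]|[/andP[ax xb] [<- <-]]];
  case=> [[/andP[x0' xa'] [<- <-]]|[/andP[ax' xb'] [<- <-]]] uu'.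
- have xx' : x <= x'.
    rewrite leNgt; apply/negP => x'x.
    by have := phase1_y_lt _ _ _ h1 _ _ x0' x'x xa; rewrite ltNge uu'.
  by split; [exact: (phase1_z_le _ _ _ h1)|exact: (phase1_speed _ _ _ h1)].
- have z1l := phase1_z_le _ _ _ h1 _ _ x0 xa (lexx a).
  have z2l := phase2_z_le _ _ _ _ _ _ h2 ya0 za0 yza _ _ (lexx a) ax' xb'.
  rewrite za in z2l; split; first exact: le_trans z2l.
  have s1 := phase1_speed _ _ _ h1 _ _ x0 xa (lexx a).
  have s2 := phase2_speed _ _ _ _ _ _ h2 ya0 za0 yza _ _ (lexx a) ax' xb'.
  rewrite ya in s2.
  have yl : 0 <= y1 a - y1 x.
    move: xa; rewrite subr_ge0 le_eqVlt => /predU1P[->//|xa].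
    exact: ltW (phase1_y_lt _ _ _ h1 _ _ x0 xa (lexx a)).
  (* The two speed bounds are added at the junction, the first one weakened from [z1 a] to
     [z2 x']. *)
  have : 0 <= (z2 x' - z1 a) * (y1 a - y1 x) by rewrite mulr_ge0 // subr_ge0.
  by lra.
(* As y is strictly increasing on each branch, this order of branches leaves only the junction
   itself. *)
- have y2x : y1 a <= y2 x.
    move: ax; rewrite -ya le_eqVlt => /predU1P[->//|ax].
    exact: ltW (phase2_y_lt _ _ _ _ _ _ h2 ya0 yza _ _ (lexx a) ax xb).
  have xE : x = a.
    apply/eqP; rewrite eq_le ax andbT leNgt; apply/negP => {}ax.
    have := phase2_y_lt _ _ _ _ _ _ h2 ya0 yza _ _ (lexx a) ax xb.
    rewrite ya ltNge => /negP; apply; apply: le_trans uu' _.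
    move: xa'; rewrite le_eqVlt => /predU1P[->//|xa'].
    exact: ltW (phase1_y_lt _ _ _ h1 _ _ x0' xa' (lexx a)).
  have xE' : x' = a.
    apply/eqP; rewrite eq_le xa' leNgt /=; apply/negP => {}xa'.
    have := phase1_y_lt _ _ _ h1 _ _ x0' xa' (lexx a).
    by rewrite ltNge (le_trans y2x).
  by rewrite xE xE' ya za !subrr mulr0.
- have xx' : x <= x'.
    rewrite leNgt; apply/negP => x'x.
    by have := phase2_y_lt _ _ _ _ _ _ h2 ya0 yza _ _ ax' x'x xb; rewrite ltNge uu'.
  by split; [exact: (phase2_z_le _ _ _ _ _ _ h2 ya0 za0 yza)|
    exact: (phase2_speed _ _ _ _ _ _ h2 ya0 za0 yza)].
Qed.

(** The second conservation law at the end point, where z = 1 - y; it turns the chip count (n^2 +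
    y^2) / 2 into 2 x_- n^2. *)
Lemma xminusE : 2 * b = (1 + y2 b ^+ 2) / 2.
Proof.
have [a0 _ _] := phase1_C1 _ _ _ h1.
have [ab _ _] := phase2_C1 _ _ _ _ _ _ h2; have [_ _ yzb] := phase2_ends _ _ _ _ _ _ h2.
have e1 := phase1_energy _ _ _ h1 a; rewrite lexx (ltW a0) in e1.
have := phase2_energy _ _ _ _ _ _ h2 yza b; rewrite lexx (ltW ab) => /(_ isT).
rewrite e1 // => /(_ erefl).
have -> : z2 b = 1 - y2 b by lra.
by lra.
Qed.

Lemma y2_end : 0 < y2 b < 1.
Proof.
have [ab _ _] := phase2_C1 _ _ _ _ _ _ h2; have [_ za yzb] := phase2_ends _ _ _ _ _ _ h2.
rewrite (phase2_y_gt0 _ _ _ _ _ _ h2 ya0 yza) ?lexx ?(ltW ab) //=.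
have := phase2_z_le _ _ _ _ _ _ h2 ya0 za0 yza _ _ (lexx a) (ltW ab) (lexx b).
by rewrite za; move: za0 yzb; lra.
Qed.

Lemma on_curve_bounds (x u v : R) : on_curve x u v ->
  [/\ 0 <= x, 0 <= v, v <= 1 - u,
      2 * v <= 1 - u -> 2 * x - u = v ^+ 2 &
      1 - u <= 2 * v -> 2 * x - u = 2 * v * (1 - u) - v ^+ 2 - (1 - u) ^+ 2 / 2].
Proof.
have [a0 _ _] := phase1_C1 _ _ _ h1; have [_ z10 _] := phase1_ends _ _ _ h1.
have [ya za _] := phase2_ends _ _ _ _ _ _ h2.
have e1 := phase1_energy _ _ _ h1.
case=> [[xa [<- <-]]|[xb [<- <-]]].
  have E := e1 _ xa; have T := phase1_touched_le _ _ _ h1 _ xa.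
  have /andP[x0 xa'] := xa.
  have v0 : 0 <= z1 x by rewrite -[leLHS]z10 (phase1_z_le _ _ _ h1).
  split=> //; [lra|lra|move=> T'].
  (* In the first phase the second formula is required only at 2z = 1 - y, where both formulas
     agree. *)
  have -> : y1 x = 1 - 2 * z1 x by lra.
  have -> : 2 * x = 1 - 2 * z1 x + z1 x ^+ 2 by rewrite -E; lra.
  by field.
have ea : 2 * a = y1 a + z1 a ^+ 2 by rewrite e1 // lexx ltW.
have E := phase2_energy _ _ _ _ _ _ h2 yza _ xb ea.
have T := phase2_touched_ge _ _ _ _ _ _ h2 za0 yza _ xb.
have G := phase2_gap_ge0 _ _ _ _ _ _ h2 za0 yza _ xb.
have /andP[ax xb'] := xb.
have v0 : z1 a <= z2 x by rewrite -za (phase2_z_le _ _ _ _ _ _ h2 ya0 za0 yza).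
split=> //; [exact: le_trans (ltW a0) ax|exact: le_trans (ltW za0) v0|lra|move=> T'].
rewrite E; have -> : y2 x = 1 - 2 * z2 x by lra.
by field.
Qed.

Lemma toppling_length_ge (n : nat) (S : R) : (1 < n)%N -> 0 <= S ->
  10 * n%:R <= S ^+ 2 ->
  (n%:R ^+ 2 + Num.max 0 (n%:R * y2 b - S) ^+ 2) / 2 - 5 / 2 * n%:R
    <= (game_length (complete_graph n))%:R.
Proof.
have /andP[yb0 yb1] := y2_end.
have ex (u : R) : exists p : R * R, 0 <= u <= y2 b -> on_curve p.1 u p.2.
  have [uu|_] := boolP (0 <= u <= y2 b).
    by have [x [v H]] := on_curve_exists u uu; exists (x, v).
  by exists (0, 0).
have [f fP] := choice ex.
have fB u (uu : 0 <= u <= y2 b) := on_curve_bounds _ _ _ (fP u uu).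
have itv u v : 0 <= u -> u <= v -> v <= y2 b -> 0 <= u <= y2 b /\ 0 <= v <= y2 b.
  by move=> u0 uv vb; rewrite u0 vb (le_trans uv vb) (le_trans u0 uv).
apply: (@profile_game_length _ (fst \o f) (snd \o f)) => /=.
- exact: ltW.
- exact: ltW.
- have u0 : 0 <= (0 : R) <= y2 b by rewrite lexx ltW.
  by have [] := fB _ u0.
- by move=> u /fB[].
- by move=> u /fB[].
- move=> u v u0 uv vb; have [uu vv] := itv _ _ u0 uv vb.
  by have [] := on_curve_le _ _ _ _ _ _ (fP _ uu) (fP _ vv) uv.
- move=> u v u0 uv vb; have [uu vv] := itv _ _ u0 uv vb.
  by have [] := on_curve_le _ _ _ _ _ _ (fP _ uu) (fP _ vv) uv.
- by move=> u /fB[].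
- by move=> u /fB[].
have bb : 0 <= y2 b <= y2 b by rewrite lexx ltW.
have [ab _ _] := phase2_C1 _ _ _ _ _ _ h2; have [_ _ yzb] := phase2_ends _ _ _ _ _ _ h2.
have C : on_curve b (y2 b) (z2 b) by right; rewrite lexx (ltW ab).
(* Monotonicity in both directions shows that the chosen point over [y2 b] has height [z2 b]. *)
have [le1 _] := on_curve_le _ _ _ _ _ _ (fP _ bb) C (lexx _).
have [le2 _] := on_curve_le _ _ _ _ _ _ C (fP _ bb) (lexx _).
by have -> : (f (y2 b)).2 = z2 b; [apply/eqP; rewrite eq_le le1|lra].
Qed.

Lemma xminus_gt : 1491 / 2500 < 2 * b.
Proof.
have [a0 _ _] := phase1_C1 _ _ _ h1.
have aa : 0 <= a <= a by rewrite lexx ltW.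
have E := phase1_exp _ _ _ h1 _ aa.
have yE : y1 a = 1 - 2 * z1 a by move: yza; lra.
rewrite yE (_ : 1 - 2 * z1 a + z1 a = 1 - z1 a) in E; last by ring.
have zh : 0 < z1 a < 1 / 2 by rewrite za0 (phase1_z_lt_half _ _ _ h1).
have := spiral_end_bound _ zh E.
rewrite -(phase2_spiral _ _ _ _ _ _ h2 ya0 za0 yza) xminusE.
by move: (y2 b ^+ 2) => t; lra.
Qed.

End Curve.

Lemma card_edges_complete (n : nat) : #|edges (complete_graph n)| = 'C(n, 2).
Proof.
rewrite -[n in RHS]card_ord -(card_draws 'I_n 2); apply: eq_card => A; rewrite !inE.
apply/imsetP/cards2P => [[[u v] /=]|[u [v [uv ->]]]].
  by rewrite inE /= => uv ->; exists u, v.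
by exists (u, v); rewrite ?inE.
Qed.

Lemma cvg_invn {R : realType} : (n%:R : R)^-1 @[n --> \oo] --> (0 : R).
Proof. by rewrite -cvg_shiftS; exact: cvg_harmonic. Qed.

Lemma cvg_invn_pred {R : realType} : (n%:R - 1 : R)^-1 @[n --> \oo] --> (0 : R).
Proof.
rewrite -cvg_shiftS (_ : [sequence _]_n = fun n => (n%:R : R)^-1).
  exact: cvg_invn.
by apply/funext => n /=; rewrite -natr1 addrK.
Qed.

(** With S = N r, the truncation at 0 and the cross term of the square cost at most 2 N^2 r, which
    is o(N^2) for r of order N^(-1/2). *)
Lemma truncated_square_ge {R : realFieldType} (N y r : R) :
  0 <= N -> 0 <= y -> y <= 1 -> 0 <= r ->
  (N * y) ^+ 2 - 2 * (N ^+ 2 * r) <= Num.max 0 (N * y - N * r) ^+ 2.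
Proof.
move=> N0 y0 y1 r0.
have rest : 0 <= N ^+ 2 * r * (1 - y) by rewrite !mulr_ge0 ?subr_ge0 ?sqr_ge0.
have sq : 0 <= N ^+ 2 * r by rewrite mulr_ge0 // sqr_ge0.
have [le|_] := leP (N * y - N * r) 0.
  have : 0 <= N * y * (N * r - N * y) by rewrite !mulr_ge0 //; lra.
  by rewrite expr0n /=; lra.
have : 0 <= (N * r) ^+ 2 by exact: sqr_ge0.
by lra.
Qed.

(* 1491 / 2500 = 0.5964 *)
Theorem theorem2p8 (R : realType) (y1 z1 y2 z2 : R -> R) (xbar xminus : R)
    (h1 : phase1 y1 z1 xbar) (h2 : phase2 y1 z1 y2 z2 xbar xminus) :
  exists e1 e2 : nat -> R,
    e1 n @[n --> \oo] --> 0 /\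
    e2 n @[n --> \oo] --> 0 /\
    \forall n \near \oo,
      (game_length (complete_graph n))%:R >= (2 * xminus + e1 n) * n%:R ^+ 2 /\
      (2 * xminus + e1 n) * n%:R ^+ 2
        = (4 * xminus + e2 n) * #|edges (complete_graph n)|%:R /\
      (4 * xminus + e2 n) * #|edges (complete_graph n)|%:R > 1491 / 2500 * n%:R ^+ 2.
Proof.
(* The square root comes from the loss S = n sqrt(10 / n), the other term from 5 n / 2. [e2] is
   chosen to make the middle equality exact, as n^2 / |E| = 2 + 2 / (n - 1). *)
pose e1 (n : nat) : R := - (Num.sqrt (10 * n%:R^-1) + 5 / 2 * n%:R^-1).
pose e2 (n : nat) : R := (2 * xminus + e1 n) * (2 + 2 * (n%:R - 1)^-1) - 4 * xminus.
have e1_0 : e1 n @[n --> \oo] --> 0.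
  rewrite (_ : 0 = - (Num.sqrt (10 * 0) + 5 / 2 * 0)); last first.
    by rewrite !mulr0 sqrtr0 addr0 oppr0.
  apply: cvgN; apply: cvgD; last by apply: cvgMr; exact: cvg_invn.
  apply: (@cvg_comp _ _ _ (fun n : nat => 10 * (n%:R : R)^-1) Num.sqrt).
    by apply: cvgMr; exact: cvg_invn.
  exact: sqrt_continuous.
exists e1, e2; split=> //; split.
  rewrite (_ : 0 = (2 * xminus + 0) * (2 + 2 * 0) - 4 * xminus); last by ring.
  apply: cvgB; last exact: cvg_cst.
  apply: cvgM; apply: cvgD; try exact: cvg_cst; first exact: e1_0.
  by apply: cvgMr; exact: cvg_invn_pred.
have gap : 0 < 2 * xminus - 1491 / 2500.
  by rewrite subr_gt0; exact: (xminus_gt _ _ _ _ _ _ h1 h2).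
near=> n.
have n1 : (1 < n)%N by near: n; exact: nbhs_infty_gt.
have n0 : (0 < n)%N by exact: ltnW.
have N0 : 0 < n%:R :> R by rewrite ltr0n.
have N1 : 0 < n%:R - 1 :> R by rewrite subr_gt0 ltr1n.
have e1n : `|e1 n| < 2 * xminus - 1491 / 2500.
  near: n; have := e1_0; move/cvgr0_norm_lt; exact.
have edgesE : (2 * xminus + e1 n) * n%:R ^+ 2
    = (4 * xminus + e2 n) * #|edges (complete_graph n)|%:R.
  rewrite card_edges_complete.
  have cE : 'C(n, 2)%:R = n%:R * (n%:R - 1) / 2 :> R.
    have := bin_ffact n 2; rewrite ffactnS ffactn1 (_ : 2`! = 2)%N // => E.
    by rewrite -(natrB _ n0) subn1 -natrM -E natrM mulfK // pnatr_eq0.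
  rewrite cE /e2 (addrC (4 * xminus)) subrK.
  by field; rewrite gt_eqF.
split; [|split] => //; last first.
  rewrite -edgesE ltr_pM2r ?exprn_gt0 //.
  by move: e1n; rewrite ltr_norml opprB ltrBlDl => /andP[].
pose r : R := Num.sqrt (10 * n%:R^-1).
have r0 : 0 <= r by exact: sqrtr_ge0.
have r2 : r ^+ 2 = 10 * n%:R^-1.
  by rewrite sqr_sqrtr // mulr_ge0 // invr_ge0 ltW.
have S0 : 0 <= n%:R * r by rewrite mulr_ge0 // ltW.
have S2 : 10 * n%:R <= (n%:R * r) ^+ 2.
  by rewrite exprMn r2 expr2 mulrCA -mulrA divff ?gt_eqF // mulr1.
apply: le_trans (toppling_length_ge _ _ _ _ _ _ h1 h2 n _ n1 S0 S2).
have /andP[yb0 yb1] := y2_end _ _ _ _ _ _ h1 h2.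
rewrite (xminusE _ _ _ _ _ _ h1 h2).
have -> : ((1 + y2 xminus ^+ 2) / 2 + e1 n) * n%:R ^+ 2
  = (n%:R ^+ 2 + (n%:R * y2 xminus) ^+ 2) / 2 - n%:R ^+ 2 * r - 5 / 2 * n%:R.
  by rewrite /e1 -/r; field; rewrite gt_eqF.
have H := truncated_square_ge _ _ _ (ltW N0) (ltW yb0) (ltW yb1) r0.
by move: (Num.max _ _ ^+ 2) ((n%:R * _) ^+ 2) (n%:R ^+ 2 * r) H => u v w H; clear -H; lra.
Unshelve. all: by end_near. Qed.
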